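(* Let $\mathcal H$ be a separable Hilbert space, let $T=(T_1,\ldots,T_n)\in\mathcal D_{\boldsymbol\mu}(\mathcal H)$ and let $\Psi_T:F^\infty(\boldsymbol\mu)\to B(\mathcal H)$ be defined by $$\Psi_T(\varphi(W))=\varphi(T):=\text{SOT-}\lim_{N\to\infty}\sum_{|\alpha|\le N}\Big(1-\frac{|\alpha|}{N+1}\Big)c_\alpha T_\alpha,$$ where $\varphi(W)\in F^\infty(\boldsymbol\mu)$ has the Fourier representation $\sum_{\alpha\in\mathbb F_n^+}c_\alpha W_\alpha$. Then $\Psi_T$ (is well defined and) has the following properties. (i) $\Psi_T\big(\sum_{|\alpha|\le m}c_\alpha W_\alpha\big)=\sum_{|\alpha|\le m}c_\alpha T_\alpha$ for $m\in\mathbb N$. (ii) $\Psi_T$ is sequentially WOT-continuous (resp. SOT-continuous). (iii) $\Psi_T$ is a completely bounded algebra homomorphism and $$\|\Psi_T\|_{cb}\le\Big\|\sum_{k=0}^\infty\sum_{|\alpha|=k}\frac1{\boldsymbol\mu(\alpha,g_0)^2}T_\alpha T_\alpha^*\Big\|^{1/2}.$$ (iv) $\Psi_T$ is $w^*$-continuous. (v) $r(\varphi(T))\le r(\varphi(W))$ for any $\varphi(W)\in F^\infty(\boldsymbol\mu)$, where $r(X)$ denotes the spectral radius of $X$.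
   Context: $\mathbb F_n^+$ is the unital free semigroup on generators $g_1,\ldots,g_n$ with identity $g_0$; $|\alpha|$ is the length of $\alpha$. $F^2(H_n)$ is the full Fock space, a Hilbert space with orthonormal basis $\{e_\alpha\}_{\alpha\in\mathbb F_n^+}$. For operators, $T_\alpha:=T_{i_1}\cdots T_{i_k}$ if $\alpha=g_{i_1}\cdots g_{i_k}$, $T_{g_0}:=I$. $\boldsymbol\mu=\{\mu_\beta\}_{\beta\in\mathbb F_n^+}$ is a sequence of strictly positive reals with $\mu_{g_0}=1$; $\boldsymbol\mu(\alpha,g_0):=\mu_{g_{i_1}\cdots g_{i_k}}\mu_{g_{i_2}\cdots g_{i_k}}\cdots\mu_{g_{i_k}}$ for $\alpha=g_{i_1}\cdots g_{i_k}$ and $\boldsymbol\mu(g_0,g_0)=1$. It is assumed that for every $i\in\{1,\ldots,n\}$ $$\sup_{\alpha}\mu_{g_i\alpha}<\infty\quad\text{and}\quad\sup_{\alpha}\frac{\boldsymbol\mu(\alpha g_i,g_0)}{\boldsymbol\mu(\alpha,g_0)}<\infty.$$ The weighted left multi-shift $W=(W_1,\ldots,W_n)$ on $F^2(H_n)$ is $W_ie_\alpha=\mu_{g_i\alpha}e_{g_i\alpha}$. The noncommutative Hardy algebra $F^\infty(\boldsymbol\mu)\subset B(F^2(H_n))$ consists of all operators $\varphi(W)$ obtained as follows: $\varphi=\sum_\alpha c_\alpha Z_\alpha$ is a formal power series such that for every $p\in\mathrm{span}\{e_\alpha\}$ one has $\sum_\alpha c_\alpha W_\alpha p\in F^2(H_n)$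 and $\|\sum_\alpha c_\alpha W_\alpha p\|\le M\|p\|$ for some constant $M$ independent of $p$; $\varphi(W)$ is the unique bounded extension of $p\mapsto\sum_\alpha c_\alpha W_\alpha p$, and $\sum_\alpha c_\alpha W_\alpha$ is called its Fourier representation. $F^\infty(\boldsymbol\mu)$ is an algebra, equal to the $w^*$-closure of the polynomials in $W_1,\ldots,W_n,I$. $\mathcal D_{\boldsymbol\mu}(\mathcal H)$ is the set of $(X_1,\ldots,X_n)\in B(\mathcal H)^n$ for which $\sum_{\alpha}\frac1{\boldsymbol\mu(\alpha,g_0)^2}X_\alpha X_\alpha^*$ converges in the weak operator topology. *)

(* Defs.v *)
From HB Require Import structures.
From mathcomp Require Import all_boot all_order all_algebra complex.
From mathcomp Require Import all_classical all_reals all_analysis.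

Set Implicit Arguments.
Unset Strict Implicit.
Unset Printing Implicit Defensive.

Import Order.TTheory GRing.Theory Num.Theory.
Import numFieldNormedType.Exports.

Local Open Scope classical_set_scope.
Local Open Scope ring_scope.
Local Open Scope complex_scope.

(* The inner product is linear in its first argument and conjugate-linear in
   the second one. *)
HB.mixin Record NormedModule_isHilbert (R : realType) H
    of CompleteNormedModule R[i] H := {
  inner : {dot H for (@Num.conj R[i])} ;
  inner_norm : forall x : H, inner x x = `|x| ^+ 2
}.

#[short(type="hilbertType")]
HB.structure Definition Hilbert (R : realType) :=
  { H of NormedModule_isHilbert R H & CompleteNormedModule R[i] H }.

(* Norms of modules over [R[i]] are (real, nonnegative) elements of [R[i]];
   [rnorm] is the same norm, seen in [R]. *)
Definition rnorm (R : realType) (V : normedModType R[i]) (x : V) : R :=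
  complex.Re `|x|.

Definition separable_space (T : topologicalType) : Prop :=
  exists D : set T, countable D /\ dense D.

Section BoundedOperators.
Variables (R : realType) (H : hilbertType R).

Definition bounded_op : {pred (H -> H)} :=
  fun f => `[< linear f /\ continuous f >].

Lemma bounded_op_submod_closed : submod_closed bounded_op.
Proof.
split.
  apply/asboolP; split; last exact: (@cst_continuous H H 0).
  by move=> a x y; rewrite /= scaler0 addr0.
move=> a f g /asboolP[lf cf] /asboolP[lg cg]; apply/asboolP; split.
  move=> b x y /=.
  rewrite -[LHS]/(a *: f (b *: x + y) + g (b *: x + y)).
  rewrite -[RHS]/(b *: (a *: f x + g x) + (a *: f y + g y)).
  by rewrite lf lg !scalerDr !scalerA (mulrC a b) addrACA.
move=> x.
have cfx : {for x, continuous (fun y => a *: f y)}.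
  by apply: (@cvgZl_tmp _ H); exact: cf.
exact: (@continuousD _ H _ _ _ _ cfx (cg x)).
Qed.

HB.instance Definition _ :=
  GRing.isSubmodClosed.Build R[i] (H -> H) bounded_op bounded_op_submod_closed.

Record bop := Bop { bop_fun :> H -> H ; bop_funP : bounded_op bop_fun }.

HB.instance Definition _ := [isSub for bop_fun].
HB.instance Definition _ := [Choice of bop by <:].
HB.instance Definition _ := [SubChoice_isSubLmodule of bop by <:].

Lemma bop_linear (A : bop) : linear A.
Proof. by have /asboolP[] := bop_funP A. Qed.

Lemma bop_continuous (A : bop) : continuous A.
Proof. by have /asboolP[] := bop_funP A. Qed.

Lemma bopP (A B : bop) : A =1 B -> A = B.
Proof. by move=> AB; apply/val_inj/funext. Qed.

Lemma bounded_op_id : bounded_op (@idfun H).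
Proof. by apply/asboolP; split=> // x; exact: cvg_id. Qed.

Lemma bounded_op_comp (A B : bop) : bounded_op (A \o B).
Proof.
apply/asboolP; split; first by move=> a x y; rewrite /= !bop_linear.
by move=> x; apply: continuous_comp; exact: bop_continuous.
Qed.

Definition bop_id : bop := Bop bounded_op_id.
Definition bop_comp (A B : bop) : bop := Bop (bounded_op_comp A B).

Let bop_compA : associative bop_comp.
Proof. by move=> A B C; apply: bopP. Qed.
Let bop_comp1 : left_id bop_id bop_comp.
Proof. by move=> A; apply: bopP. Qed.
Let bop_1comp : right_id bop_id bop_comp.
Proof. by move=> A; apply: bopP. Qed.
Let bop_compDl : left_distributive bop_comp +%R.
Proof. by move=> A B C; apply: bopP. Qed.
Let bop_compDr : right_distributive bop_comp +%R.
Proof.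
move=> A B C; apply: bopP => x /=.
have := bop_linear A 1 (B x) (C x); rewrite !scale1r => AE.
by rewrite -[RHS]/(A (B x) + A (C x)) -AE.
Qed.

(* The product of B(H) is composition; H may be the zero space, hence a
   possibly zero ring. *)
HB.instance Definition _ := GRing.Zmodule_isPzRing.Build bop
  bop_compA bop_comp1 bop_1comp bop_compDl bop_compDr.

End BoundedOperators.

Section OperatorNotions.
Variables (R : realType) (H : hilbertType R).
Implicit Types (A B : bop H) (x y : H).

Definition opnorm A : R := sup [set rnorm (A x) | x in [set x | rnorm x <= 1]].

Definition is_adjoint A B := forall x y, inner (A x) y = inner x (B y).

(* By the Riesz representation theorem every [A : bop H] has a unique
   adjoint, so that the default value [0] is never used. *)
Definition adjoint A : bop H := xget 0 [set B | is_adjoint A B].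

Definition spectrum A : set R[i] :=
  [set z | ~ exists B, B * (A - z *: (1 : bop H)) = 1 /\
                       (A - z *: (1 : bop H)) * B = 1].

(* [-oo] if the spectrum is empty, that is, if [H] is the zero space. *)
Definition spectral_radius A : \bar R :=
  ereal_sup [set (complex.Re `|z|)%:E | z in spectrum A].

(* [k x k] matrices of operators act on the Hilbert space direct sum of [k]
   copies of [H]. *)
Definition mxop_norm k (M : 'M[bop H]_k) : R :=
  sup [set Num.sqrt (\sum_i rnorm (\sum_j M i j (v j)) ^+ 2) |
       v in [set v : 'I_k -> H | \sum_j rnorm (v j) ^+ 2 <= 1]].

Definition sot : Type :=
  initial_topology (fun A : bop H => (A : H -> H) : {ptws H -> H}).
HB.instance Definition _ := Topological.on sot.

Definition wot : Type :=
  initial_topology (fun A : bop H =>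
    (fun p : H * H => inner (A p.1) p.2) : {ptws (H * H)%type -> R[i]^o}).
HB.instance Definition _ := Topological.on wot.

Definition sqsummable (x : nat -> H) : Prop :=
  cvgn (series (fun k => `|x k| ^+ 2 : R[i]^o)).

Definition sqseq : Type := {x : nat -> H | sqsummable x}.

(* B(H) is the dual of the space of trace class operators, acting by
   [A |-> tr (A t)]. With [t = sum_k <., y_k> x_k], where [x] and [y] are square
   summable (which is the general form of a trace class operator), this is
   [A |-> sum_k <A x_k, y_k>]; these functionals define the w*-topology. *)
Definition normal_functional (p : sqseq * sqseq) A : R[i]^o :=
  limn (series (fun k => inner (A (sval p.1 k)) (sval p.2 k) : R[i]^o)).

Definition wstar : Type :=
  initial_topology (fun A : bop H =>
    normal_functional^~ A : {ptws (sqseq * sqseq)%type -> R[i]^o}).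
HB.instance Definition _ := Topological.on wstar.

End OperatorNotions.

Section OperatorConvergence.
Variables (R : realType) (H : hilbertType R).

Lemma cvg_initial_topologyP (S : choiceType) (T : topologicalType) (f : S -> T)
    (F : set_system S) (s : S) : Filter F ->
  F --> (s : initial_topology f) <-> f @ F --> f s.
Proof.
move=> FF; split=> [Fs|fFs].
  by move=> B /(@initial_continuous S T f s); exact: Fs.
move=> A /= [_ [[B Bop <-] Bfs sBfA]].
have /fFs FB : nbhs (f s) B by rewrite nbhsE; exists B.
exact: (@filterS _ F FF _ _ sBfA FB).
Qed.

Lemma cvg_ptwsP (U : Type) (V : topologicalType) (F : set_system (U -> V))
    (f : U -> V) : Filter F ->
  F --> (f : {ptws U -> V}) <-> (forall t, (fun g => g t) @ F --> f t).
Proof.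
move=> FF; split=> [/cvg_sup h t|h].
  by have /cvg_initial_topologyP := h t.
by apply/cvg_sup => t; apply/cvg_initial_topologyP; exact: h.
Qed.

Lemma sot_cvgP (A : nat -> bop H) (L : bop H) :
  (A @ \oo --> (L : sot H)) <->
  (forall x : H, A N x @[N --> \oo] --> L x).
Proof. by rewrite cvg_initial_topologyP cvg_ptwsP. Qed.

Lemma wot_cvgP (A : nat -> bop H) (L : bop H) :
  (A @ \oo --> (L : wot H)) <->
  (forall x y : H, (inner (A N x) y : R[i]^o) @[N --> \oo] -->
                   (inner (L x) y : R[i]^o)).
Proof.
rewrite cvg_initial_topologyP cvg_ptwsP; split=> [h x y|h [x y]].
  exact: (h (x, y)).
exact: h.
Qed.

Lemma wstar_cvgP (F : set_system (bop H)) (L : bop H) : Filter F ->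
  (F --> (L : wstar H)) <->
  (forall p, normal_functional p A @[A --> F] --> normal_functional p L).
Proof.
move=> FF; rewrite cvg_initial_topologyP.
by rewrite cvg_ptwsP.
Qed.

End OperatorConvergence.

(* Completely bounded norm of the restriction of [Psi] to a subspace [D] of
   B(K). *)
Definition cb_norm (R : realType) (K H : hilbertType R) (D : set (bop K))
    (Psi : bop K -> bop H) : \bar R :=
  ereal_sup [set r | exists k (M : 'M[bop K]_k),
    [/\ forall i j, D (M i j), mxop_norm M <= 1 &
        r = (mxop_norm (map_mx Psi M))%:E]].

Definition completely_bounded (R : realType) (K H : hilbertType R)
    (D : set (bop K)) (Psi : bop K -> bop H) : Prop :=
  (cb_norm D Psi < +oo)%E.

Definition unital_subalgebra (R : realType) (K : hilbertType R)
    (D : set (bop K)) : Prop :=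
  [/\ D 1, forall a A B, D A -> D B -> D (a *: A + B) &
      forall A B, D A -> D B -> D (A * B)].

Definition unital_algebra_hom (R : realType) (K H : hilbertType R)
    (D : set (bop K)) (Psi : bop K -> bop H) : Prop :=
  [/\ Psi 1 = 1,
      forall a A B, D A -> D B -> Psi (a *: A + B) = a *: Psi A + Psi B &
      forall A B, D A -> D B -> Psi (A * B) = Psi A * Psi B].

(* The free semigroup on [n] generators is [seq 'I_n] under concatenation; its
   identity is [[::]] and the length of a word is its size. *)
Notation word n := (seq 'I_n).

Section Weights.
Variables (R : realType) (n : nat).
Implicit Type mu : word n -> R.

(* [bmu mu al] is the weight mu(al, g_0) of the pair of words (al, g_0). *)
Fixpoint bmu mu (al : word n) : R :=
  if al is i :: be then mu (i :: be) * bmu mu be else 1.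

Definition admissible_weights mu : Prop :=
  [/\ mu [::] = 1, forall al, 0 < mu al,
      forall i, has_ubound (range (fun al => mu (i :: al))) &
      forall i, has_ubound (range (fun al => bmu mu (rcons al i) / bmu mu al))].

End Weights.

Section FreeSums.
Variables (R : realType) (n : nat) (H : hilbertType R).
Implicit Types (T : 'I_n -> bop H) (c : word n -> R[i]).

Definition opword T (al : word n) : bop H := \prod_(i <- al) T i.

(* The sum of [f al] over the words [al] of length at most [N]. *)
Definition free_sum (V : zmodType) (f : word n -> V) (N : nat) : V :=
  \sum_(k < N.+1) \sum_(al : k.-tuple 'I_n) f al.

Definition free_poly T c (N : nat) : bop H :=
  free_sum (fun al => c al *: opword T al) N.

Definition cesaro T c (N : nat) : bop H :=
  free_sum (fun al =>
    (1 - (size al)%:R / N.+1%:R) * c al *: opword T al) N.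

(* The terms are positive operators, hence the order of summation does not
   matter; they are grouped by length. *)
Definition dmu_sum (mu : word n -> R) T (S : bop H) : Prop :=
  free_sum (fun al => ((bmu mu al) ^- 2)%:C *:
                      (opword T al * adjoint (opword T al))) @ \oo
  --> (S : wot H).

Definition dmu (mu : word n -> R) : set ('I_n -> bop H) :=
  [set T | exists S, dmu_sum mu T S].

End FreeSums.

Section HardyAlgebra.
Variables (R : realType) (n : nat) (F : hilbertType R).
Variables (e : word n -> F) (W : 'I_n -> bop F).
Implicit Types (c : word n -> R[i]) (A : bop F).

Definition lspan : set F :=
  [set p | exists (s : seq (word n)) (d : word n -> R[i]),
             p = \sum_(al <- s) d al *: e al].

Definition orthonormal_basis : Prop :=
  (forall al be, inner (e al) (e be) = (al == be)%:R) /\ dense lspan.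

Definition weighted_left_shift (mu : word n -> R) : Prop :=
  forall i al, W i (e al) = (mu (i :: al))%:C *: e (i :: al).

Definition multiplier c : Prop :=
  (forall p, lspan p -> cvgn (fun N => free_poly W c N p)) /\
  exists M : R, forall p, lspan p ->
    rnorm (limn (fun N => free_poly W c N p)) <= M * rnorm p.

(* [A] is the operator phi(W), for phi = sum_al c_al Z_al. *)
Definition fourier_rep A c : Prop :=
  multiplier c /\
  forall p, lspan p -> A p = limn (fun N => free_poly W c N p).

Definition Finfty : set (bop F) := [set A | exists c, fourier_rep A c].

End HardyAlgebra.

(* [Psi] is the map Psi_T; its values outside of [Finfty e W] are
   irrelevant. *)
Definition functional_calculus (R : realType) (n : nat) (F H : hilbertType R)
    (e : word n -> F) (W : 'I_n -> bop F) (T : 'I_n -> bop H)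
    (Psi : bop F -> bop H) : Prop :=
  forall A c, fourier_rep e W A c -> cesaro T c @ \oo --> (Psi A : sot H).

(* Main.v *)
(** Let [K : H -> F (x) H] be the Poisson kernel
    [K h = sum_al e_al (x) T_al^* h / mu(al, g_0)]. It is bounded because
    [K^* K = S], and [K^* (W_i (x) I) = T_i K^*]. Hence
    [Psi A h = K^* (A e_0 (x) h)] maps [W_al] to [T_al]. It makes sense for every
    [A] in B(F), and since [e_0] is a unit vector, it is completely bounded by
    [|S|^(1/2)] and continuous for the WOT, the SOT and the w*-topology. On
    F^infty, [K^* (A f (x) h) = Psi A (K^* (f (x) h))], which gives
    multiplicativity. The Cesaro means converge because the Fejer means of
    [A e_0] converge in norm. Finally F^infty is the commutant of the bounded
    weighted right shifts, so that it is an algebra closed under inverses, and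
    the spectrum of [Psi A] is contained in that of [A]. *)
Require Import Defs.
From HB Require Import structures.
From mathcomp Require Import all_boot all_order all_algebra complex.
From mathcomp Require Import all_classical all_reals all_analysis.
From mathcomp Require Import ring lra.
Set Implicit Arguments.
Unset Strict Implicit.
Unset Printing Implicit Defensive.

Import Order.TTheory GRing.Theory Num.Theory.
Import numFieldNormedType.Exports.
Local Open Scope classical_set_scope.
Local Open Scope ring_scope.
Local Open Scope complex_scope.

(** * Complex modulus, norms and convergence *)

(** The space F (x) H is never built: [K^*] enters only through the operators
    [G f : h |-> K^* (f (x) h)], linear in [f]. For fixed [h], [G f h] is the limit of the sums of
    [<f, e_al> T_al h / mu(al, g_0)]. These converge because a bounded map and its adjoint have the
    same bound, a fact applied to finite truncations of [K]. Only complete boundedness involves sums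
    of elementary tensors; there, orthonormal coordinates for the finitely many vectors of [H] at
    hand lead back to the same bound. Evaluation at [e_0] is the right one because
    [<A e_0, e_al> = c_al mu(al, g_0)]: these weights cancel those of [K^*], so that [G (A e_0)] is
    formally the sum of the [c_al T_al]. Since [Psi A] depends on [A] through the vector [A e_0]
    alone, a functional such as [<Psi A x, y>], or a normal functional of [Psi A], has by Riesz the
    form [<A e_0, z>], which is continuous for the WOT and the w*-topology alike. *)

Section ComplexModulus.
Context {R : realType}.
Implicit Types (z w : R[i]) (a b : R).

Definition cabs z : R := complex.Re `|z|.

Lemma cabsE z : `|z| = (cabs z)%:C.
Proof. by rewrite /cabs normc_def. Qed.

Lemma cabs_ge0 z : 0 <= cabs z.
Proof. by rewrite -lecR -cabsE normr_ge0. Qed.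

Lemma cabsM z w : cabs (z * w) = cabs z * cabs w.
Proof. by apply: complexI; rewrite rmorphM -!cabsE normrM. Qed.

Lemma cabsN z : cabs (- z) = cabs z.
Proof. by rewrite /cabs normrN. Qed.

Lemma cabs_eq0 z : cabs z = 0 -> z = 0.
Proof. by move=> z0; apply/eqP; rewrite -normr_eq0 cabsE z0. Qed.

Lemma cabs0 : cabs 0 = 0. Proof. by rewrite /cabs normr0. Qed.

Lemma cabs_real a : cabs a%:C = `|a|.
Proof. by rewrite /cabs normc_def /= expr0n /= addr0 sqrtr_sqr. Qed.

Lemma conj_real a : Num.conj (a%:C : R[i]) = a%:C.
Proof. by rewrite -[LHS]/(conjc _) /= oppr0. Qed.

Lemma gt0_complexE z : 0 < z -> z = (complex.Re z)%:C.
Proof. by case: z => a b; rewrite ltcE /= => /andP[/eqP->]. Qed.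

Lemma mulC_conj z : z * Num.conj z = (cabs z ^+ 2)%:C.
Proof. by rewrite -normCK cabsE rmorphXn. Qed.

Lemma cRe_le_cabs z : complex.Re z <= cabs z.
Proof.
apply: le_trans (ler_norm _) _.
by rewrite -lecR -cabsE normc_ge_Re.
Qed.

Lemma cReD z w : complex.Re (z + w) = complex.Re z + complex.Re w.
Proof. by case: z; case: w. Qed.

Lemma cReN z : complex.Re (- z) = - complex.Re z.
Proof. by case: z. Qed.

Lemma cReZ a z : complex.Re (a%:C * z) = a * complex.Re z.
Proof. by case: z => x y /=; rewrite mul0r subr0. Qed.

Lemma cRe_conj z : complex.Re (Num.conj z) = complex.Re z.
Proof. by case: z. Qed.

End ComplexModulus.

Section RealNorm.
Context {R : realType} {V : normedModType R[i]}.
Implicit Types (x y : V) (a : R[i]).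

Lemma rnormE x : `|x| = (rnorm x)%:C.
Proof.
rewrite /rnorm; have := normr_ge0 x; case: (`|x|) => a b.
by rewrite lecE /= => /andP[/eqP-> _].
Qed.

Lemma rnorm_ge0 x : 0 <= rnorm x.
Proof. by rewrite -lecR -rnormE normr_ge0. Qed.

Lemma rnorm0 : rnorm (0 : V) = 0.
Proof. by rewrite /rnorm normr0. Qed.

Lemma rnorm_eq0 x : rnorm x = 0 -> x = 0.
Proof. by move=> x0; apply/eqP; rewrite -normr_eq0 rnormE x0. Qed.

Lemma rnormN x : rnorm (- x) = rnorm x.
Proof. by rewrite /rnorm normrN. Qed.

Lemma rnormB_sym x y : rnorm (x - y) = rnorm (y - x).
Proof. by rewrite -rnormN opprB. Qed.

Lemma rnormD x y : rnorm (x + y) <= rnorm x + rnorm y.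
Proof. by rewrite -lecR rmorphD /= -!rnormE ler_normD. Qed.

Lemma rnormB_triangle y x z : rnorm (x - z) <= rnorm (x - y) + rnorm (y - z).
Proof. by rewrite (le_trans _ (rnormD _ _))// addrA subrK. Qed.

Lemma rnormZ a x : rnorm (a *: x) = cabs a * rnorm x.
Proof. by apply: complexI; rewrite rmorphM /= -!rnormE -cabsE normrZ. Qed.

Lemma rnorm_sum I (r : seq I) (P : pred I) (f : I -> V) :
  rnorm (\sum_(i <- r | P i) f i) <= \sum_(i <- r | P i) rnorm (f i).
Proof.
elim/big_rec2: _ => [|i a x _ xa]; first by rewrite rnorm0.
by rewrite (le_trans (rnormD _ _))// lerD2l.
Qed.

Lemma cvg_rnormP {T : Type} {F : set_system T} {FF : Filter F} (u : T -> V) x :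
  u @ F --> x <-> forall d : R, 0 < d -> \forall t \near F, rnorm (x - u t) < d.
Proof.
rewrite cvgrPdist_lt; split=> h d d0.
  have /h : 0 < d%:C by rewrite ltcR.
  by apply: filterS => t; rewrite rnormE ltcR.
have dE := gt0_complexE d0.
have /h : 0 < complex.Re d by rewrite -ltcR -dE.
by apply: filterS => t; rewrite rnormE -ltcR -dE.
Qed.

Lemma cvg_seq_rnormP (u : nat -> V) x :
  u @ \oo --> x <->
  forall d : R, 0 < d -> exists N, forall k, (N <= k)%N -> rnorm (x - u k) < d.
Proof.
rewrite (@cvg_rnormP _ \oo%classic _); split=> h d d0.
  by have [N _ hN] := h d d0; exists N.
by have [N hN] := h d d0; exists N.
Qed.

Lemma dense_rnorm (D : set V) x (d : R) : dense D -> 0 < d ->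
  exists p, D p /\ rnorm (x - p) < d.
Proof.
move=> D_dense d0; have d0' : 0 < d%:C :> R[i] by rewrite ltcR.
have [p [dp Dp]] :=
  D_dense _ (ex_intro _ x (ballxx x d0')) (ball_open x d%:C).
exists p; split=> //; move: dp.
have E := congr1 (fun b : V -> R[i] -> set V => b x d%:C p)
  (@ball_normE R[i] V).
by rewrite -[X in X -> _]E /= rnormE ltcR.
Qed.

Lemma cvg_rnorm_le (u : nat -> V) x (M : R) :
  u @ \oo --> x -> (forall k, rnorm (u k) <= M) -> rnorm x <= M.
Proof.
move=> /cvg_seq_rnormP ux uM; apply/ler_addgt0Pl => d d0.
have [N /(_ N (leqnn N)) xN] := ux d d0.
rewrite -[x](subrK (u N)) (le_trans (rnormD _ _))// lerD ?uM//.
exact: ltW.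
Qed.

Lemma cvg_eventually_cst (u : nat -> V) x N :
  (forall k, (N <= k)%N -> u k = x) -> u @ \oo --> x.
Proof.
move=> ux; apply/cvg_seq_rnormP => d d0; exists N => k /ux ->.
by rewrite subrr rnorm0.
Qed.

Lemma cvg_seq_unique (u : nat -> V) x y :
  u @ \oo --> x -> u @ \oo --> y -> x = y.
Proof. exact: (cvg_unique (@norm_hausdorff _ V)). Qed.

Lemma cvg_seq_ext (u v : nat -> V) x :
  u =1 v -> u @ \oo --> x -> v @ \oo --> x.
Proof. by move=> /funext ->. Qed.

Lemma cvg_seqD (u v : nat -> V) x y :
  u @ \oo --> x -> v @ \oo --> y -> (fun k => u k + v k) @ \oo --> x + y.
Proof. exact: cvgD. Qed.

Lemma cvg_seqZ (u : nat -> V) a x :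
  u @ \oo --> x -> (fun k => a *: u k) @ \oo --> a *: x.
Proof. exact: cvgZl_tmp. Qed.

Lemma cvg_seq_sum I (r : seq I) (u : I -> nat -> V) (x : I -> V) :
  (forall i, u i @ \oo --> x i) ->
  (fun k => \sum_(i <- r) u i k) @ \oo --> \sum_(i <- r) x i.
Proof.
move=> ux; elim: r => [|i r IH].
  apply: (@cvg_eventually_cst _ _ 0) => k _; by rewrite !big_nil.
rewrite big_cons; under [X in X @ _]funext do rewrite big_cons.
exact: cvg_seqD.
Qed.

End RealNorm.

Lemma cauchy_rnorm_cvg {R : realType} {V : completeNormedModType R[i]}
    (u : nat -> V) :
  (forall d : R, 0 < d ->
     exists N, forall j k, (N <= j)%N -> (N <= k)%N -> rnorm (u j - u k) < d) ->
  exists x : V, u @ \oo --> x.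
Proof.
move=> uC; suff /cvg_ex[x ux] : cvgn u by exists x.
apply/cauchy_cvgP/cauchyP => d d0.
have dE := gt0_complexE d0.
have /uC[N uN] : 0 < complex.Re d by rewrite -ltcR -dE.
exists (u N), N => // k /= Nk.
by rewrite -ball_normE /= rnormE dE ltcR uN.
Qed.

Section LinearFunctions.
Context {R : realType} {U V : normedModType R[i]} (f : U -> V).
Hypothesis f_lin : linear f.

Lemma linear_fun0 : f 0 = 0.
Proof. by have := f_lin (-1) 0 0; rewrite scaler0 addr0 scaleN1r addNr. Qed.

Lemma linear_funD x y : f (x + y) = f x + f y.
Proof. by have := f_lin 1 x y; rewrite !scale1r. Qed.

Lemma linear_funZ a x : f (a *: x) = a *: f x.
Proof. by have := f_lin a x 0; rewrite linear_fun0 !addr0. Qed.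

Lemma linear_funB x y : f (x - y) = f x - f y.
Proof. by rewrite linear_funD -scaleN1r linear_funZ scaleN1r. Qed.

Lemma linear_fun_sum I (r : seq I) (P : pred I) (g : I -> U) :
  f (\sum_(i <- r | P i) g i) = \sum_(i <- r | P i) f (g i).
Proof. exact: (big_morph f linear_funD linear_fun0). Qed.

Lemma linear_lipschitz_cvg (M : R) : (forall x, rnorm (f x) <= M * rnorm x) ->
  forall (u : nat -> U) x, u @ \oo --> x -> (fun k => f (u k)) @ \oo --> f x.
Proof.
move=> fM u x /cvg_seq_rnormP ux; apply/cvg_seq_rnormP => d d0.
(* [M] is an arbitrary real; [|M| + 1] is a Lipschitz constant that can be divided by. *)
have M0 : 0 < `|M| + 1 by rewrite ltr_wpDl.
have [N uN] := ux (d / (`|M| + 1)) (divr_gt0 d0 M0).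
exists N => k /uN; rewrite ltr_pdivlMr// => /(le_lt_trans _); apply.
rewrite -linear_funB (le_trans (fM _))// mulrC ler_wpM2l ?rnorm_ge0//.
by rewrite (le_trans (ler_norm M))// lerDl.
Qed.

Lemma linear_lipschitz_continuous (M : R) :
  (forall x, rnorm (f x) <= M * rnorm x) -> continuous f.
Proof.
move=> fM x; apply/cvg_rnormP => d d0.
have M0 : 0 < `|M| + 1 by rewrite ltr_wpDl.
have := @cvg_id _ (nbhs x) => /cvg_rnormP /(_ _ (divr_gt0 d0 M0)).
apply: filterS => y; rewrite ltr_pdivlMr// => /(le_lt_trans _); apply.
rewrite -linear_funB (le_trans (fM _))// mulrC ler_wpM2l ?rnorm_ge0//.
by rewrite (le_trans (ler_norm M))// lerDl.
Qed.

(** Continuity at 0 sends a ball of radius [s] into the unit ball; rescaling any [x] to norm [s / 2]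
    gives the constant [2 / s]. *)
Lemma linear_continuous_lipschitz : continuous f ->
  exists M : R, 0 <= M /\ forall x, rnorm (f x) <= M * rnorm x.
Proof.
move=> /(_ 0) /cvg_rnormP /(_ 1 ltr01); rewrite linear_fun0.
move=> /nbhs_ballP[r /= r0 hr].
have rE := gt0_complexE r0.
set s := complex.Re r in rE; have s0 : 0 < s by rewrite -ltcR -rE.
exists (2 / s); split=> [|x]; first by rewrite divr_ge0// ltW.
have [x0|x0] := eqVneq (rnorm x) 0.
  by rewrite (rnorm_eq0 x0) linear_fun0 !rnorm0 mulr0.
have x0' : 0 < rnorm x by rewrite lt_neqAle eq_sym x0 rnorm_ge0.
pose t : R := s / (2 * rnorm x).
have t0 : 0 < t by rewrite divr_gt0 // mulr_gt0.
have := hr (t%:C *: x); rewrite -ball_normE /= !sub0r normrN rnormN rnormE rE.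
rewrite ltcR linear_funZ !rnormZ cabs_real gtr0_norm//.
have -> : t * rnorm x = s / 2 by rewrite /t; field.
rewrite ltr_pdivrMr// mulr2n mulrDr mulr1 ltrDl s0 => /(_ isT) /ltW.
by rewrite -ler_pdivlMl// mulr1 /t invf_div mulrAC.
Qed.

End LinearFunctions.

(** * Hilbert spaces *)

Section InnerProduct.
Context {R : realType} {H : hilbertType R}.
Implicit Types (x y z : H) (a : R[i]).

Lemma innerDl x y z : inner (x + y) z = inner x z + inner y z.
Proof. exact: linearDl. Qed.

Lemma innerBl x y z : inner (x - y) z = inner x z - inner y z.
Proof. exact: linearBl. Qed.

Lemma innerZl a x y : inner (a *: x) y = a * inner x y.
Proof. exact: linearZl_LR. Qed.

Lemma innerDr x y z : inner x (y + z) = inner x y + inner x z.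
Proof. exact: linearDr. Qed.

Lemma innerBr x y z : inner x (y - z) = inner x y - inner x z.
Proof. exact: linearBr. Qed.

Lemma innerZr a x y : inner x (a *: y) = Num.conj a * inner x y.
Proof. exact: linearZr_LR. Qed.

Lemma inner_suml I (r : seq I) (P : pred I) (f : I -> H) y :
  inner (\sum_(i <- r | P i) f i) y = \sum_(i <- r | P i) inner (f i) y.
Proof. exact: linear_sumlz. Qed.

Lemma inner_sumr I (r : seq I) (P : pred I) (f : I -> H) x :
  inner x (\sum_(i <- r | P i) f i) = \sum_(i <- r | P i) inner x (f i).
Proof. exact: linear_sumr. Qed.

Lemma innerC x y : inner x y = Num.conj (inner y x).
Proof. by rewrite hermC expr0 mul1r. Qed.

Lemma inner_rnorm x : inner x x = (rnorm x ^+ 2)%:C.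
Proof. by rewrite inner_norm rnormE rmorphXn. Qed.

Lemma rnorm_sqr x : rnorm x ^+ 2 = complex.Re (inner x x).
Proof. by rewrite inner_rnorm. Qed.

Lemma Re_innerC x y : complex.Re (inner x y) = complex.Re (inner y x).
Proof. by rewrite innerC cRe_conj. Qed.

Lemma rnorm_sqrD x y : rnorm (x + y) ^+ 2 =
  rnorm x ^+ 2 + rnorm y ^+ 2 + 2 * complex.Re (inner x y).
Proof.
rewrite !rnorm_sqr innerDl !innerDr !cReD (Re_innerC y x); ring.
Qed.

Lemma rnorm_sqrB x y : rnorm (x - y) ^+ 2 =
  rnorm x ^+ 2 + rnorm y ^+ 2 - 2 * complex.Re (inner x y).
Proof.
rewrite !rnorm_sqr innerBl !innerBr !(cReD, cReN) (Re_innerC y x); ring.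
Qed.

Lemma cauchy_schwarz x y : cabs (inner x y) <= rnorm x * rnorm y.
Proof.
have [y0|y0] := eqVneq (rnorm y) 0.
  rewrite (rnorm_eq0 y0) -(scale0r (0 : H)) innerZr conjC0 mul0r cabs0.
  by rewrite scale0r mulr_ge0// rnorm_ge0.
have N0 : 0 < rnorm y ^+ 2 by rewrite exprn_gt0// lt_neqAle eq_sym y0 rnorm_ge0.
rewrite -(@ler_pXn2r _ 2)// ?nnegrE ?mulr_ge0 ?rnorm_ge0 ?cabs_ge0//.
set w := inner x y.
(* Expanded, this square is [|y|^2 (|x|^2 |y|^2 - |w|^2)]; scaling [x] by [|y|^2] instead of
   dividing keeps the expansion polynomial. *)
have := sqr_ge0 (rnorm ((rnorm y ^+ 2)%:C *: x - w *: y)).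
rewrite rnorm_sqrB !rnormZ cabs_real innerZl innerZr -/w.
rewrite (mulrC (Num.conj w)) mulC_conj cReZ /= gtr0_norm// => h.
rewrite exprMn -(ler_pM2l N0) -subr_ge0.
by move: h; congr (0 <= _); ring.
Qed.

Lemma cvg_innerl (u : nat -> H) x y : u @ \oo --> x ->
  (fun k => inner (u k) y : R[i]^o) @ \oo --> (inner x y : R[i]^o).
Proof.
apply: (@linear_lipschitz_cvg R H R[i]^o (inner^~ y) _ (rnorm y)) => [a v w|v].
  by rewrite innerDl innerZl.
by rewrite mulrC; exact: cauchy_schwarz.
Qed.

Lemma cvg_innerr (u : nat -> H) x y : u @ \oo --> x ->
  (fun k => inner y (u k) : R[i]^o) @ \oo --> (inner y x : R[i]^o).
Proof.
move=> /cvg_seq_rnormP ux; apply/cvg_seq_rnormP => d d0.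
have y0 : 0 < rnorm y + 1 by rewrite ltr_wpDl ?rnorm_ge0.
have [N uN] := ux (d / (rnorm y + 1)) (divr_gt0 d0 y0).
exists N => k /uN; rewrite ltr_pdivlMr// => /(le_lt_trans _); apply.
rewrite -innerBr (le_trans (cauchy_schwarz _ _))// mulrC.
by rewrite ler_wpM2l ?rnorm_ge0// lerDl.
Qed.

Lemma inner_inj x y : (forall z, inner z x = inner z y) -> x = y.
Proof.
move=> xy; apply/eqP; rewrite -subr_eq0; apply/eqP/rnorm_eq0/eqP.
by rewrite -sqrf_eq0 rnorm_sqr innerBr xy subrr.
Qed.

(* [z] is the limit of a minimizing sequence of the convex functional
   [|x|^2 - 2 Re (phi x)], which is Cauchy by the parallelogram law. *)
Lemma riesz (phi : H -> R[i]) (M : R) :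
  (forall a x y, phi (a *: x + y) = a * phi x + phi y) ->
  (forall x, cabs (phi x) <= M * rnorm x) ->
  exists z, forall x, phi x = inner x z.
Proof.
move=> phi_lin phi_bd.
have phi0 : phi 0 = 0.
  by have := phi_lin (-1) 0 0; rewrite scaler0 addr0 mulN1r addNr.
have phiZ a x : phi (a *: x) = a * phi x.
  by have := phi_lin a x 0; rewrite phi0 !addr0.
have phiD x y : phi (x + y) = phi x + phi y.
  by have := phi_lin 1 x y; rewrite scale1r mul1r.
pose J x := rnorm x ^+ 2 - 2 * complex.Re (phi x).
(* From [Re (phi x) <= M |x|], completing the square: [|x|^2 - 2 M |x| = (|x| - M)^2 - M^2]. *)
have J_lb x : - M ^+ 2 <= J x.
  have := phi_bd x; have := cRe_le_cabs (phi x); have := sqr_ge0 (rnorm x - M).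
  rewrite /J; nra.
have J_inf : has_inf (range J).
  by split; [exists (J 0), 0|exists (- M ^+ 2) => _ [x _ <-]].
pose m := inf (range J).
have mJ x : m <= J x by apply: ge_inf; [exact: J_inf.2|exists x].
have /choice[u uJ] : forall k, exists x, J x < m + k.+1%:R^-1.
  move=> k.
  have k0 : 0 < k.+1%:R^-1 :> R by rewrite invr_gt0.
  by have [_ [x _ <-] ?] := inf_adherent k0 J_inf; exists x.
have inv_small (d : R) : 0 < d ->
    exists N, forall k, (N <= k)%N -> k.+1%:R^-1 < d.
  move=> d0; exists (Num.truncn d^-1) => k Nk.
  rewrite invf_plt ?posrE//; apply: lt_le_trans (truncnS_gt _) _.
  by rewrite ler_nat.
(* The linear terms of [J] cancel here. As [J] is at least [m] at the midpoint, two near-minimizers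
   are close to each other. *)
have midpoint x y :
    J x + J y - 2 * J ((2^-1)%:C *: (x + y)) = rnorm (x - y) ^+ 2 / 2.
  rewrite /J rnormZ cabs_real phiZ phiD cReZ cReD exprMn (rnorm_sqrD x y).
  by rewrite rnorm_sqrB real_normK ?num_real//; field.
have [z uz] : exists z : H, u @ \oo --> z.
  apply: cauchy_rnorm_cvg => d d0.
  have [N hN] := inv_small (d ^+ 2 / 4) (divr_gt0 (exprn_gt0 _ d0) (ltr0Sn _ _)).
  exists N => j k /hN Nj /hN Nk.
  rewrite -(@ltr_pXn2r _ 2)// ?nnegrE ?rnorm_ge0 ?(ltW d0)//.
  have := midpoint (u j) (u k); have := mJ ((2^-1)%:C *: (u j + u k)).
  have := uJ j; have := uJ k; move: Nj Nk.
  move: (_ ^+ 2) (d ^+ 2) (J (u j)) (J (u k)) (J _) (j.+1%:R^-1) (k.+1%:R^-1) => *.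
  lra.
(* At the vector [Num.conj w *: x] the difference equals [|w|^2], so real parts are enough. *)
exists z; suff Re0 x : complex.Re (inner x z - phi x) = 0.
  move=> x; apply/esym/eqP; rewrite -subr_eq0; set w := _ - _.
  apply/eqP/cabs_eq0/eqP.
  rewrite -sqrf_eq0; apply/eqP; have := Re0 (Num.conj w *: x).
  by rewrite innerZl phiZ -mulrBr -/w mulrC mulC_conj.
set r := complex.Re _.
(* First-order condition at the minimum: [J (u k + s x) >= m] is compared with
   [J (u k) < m + 1 / (k + 1)], and [k] tends to infinity. *)
have r_ge s : 0 <= s ^+ 2 * rnorm x ^+ 2 + 2 * s * r.
  apply/ler_addgt0Pl => d d0.
  have d40 : 0 < d / (4 * (`|s| + 1)).
    by rewrite divr_gt0// mulr_gt0// ltr_wpDl.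
  have [N1 hN1] := inv_small (d / 2) (divr_gt0 d0 (ltr0Sn _ _)).
  have /cvg_seq_rnormP /(_ _ d40) [N2 hN2] := @cvg_innerr u z x uz.
  have := hN1 _ (leq_maxl N1 N2); have := hN2 _ (leq_maxr N1 N2).
  set k := maxn N1 N2 => zk kd.
  have := mJ (u k + s%:C *: x); have := uJ k.
  rewrite /J rnorm_sqrD rnormZ cabs_real phiD phiZ innerZr cReD.
  rewrite conj_real !cReZ exprMn real_normK ?num_real// (Re_innerC (u k)).
  have : `|s * complex.Re (inner x z - inner x (u k))| <= d / 4.
    rewrite normrM.
    apply: le_trans (_ : `|s| * (d / (4 * (`|s| + 1))) <= _).
      rewrite ler_wpM2l//; apply: ltW; apply: le_lt_trans zk.
      by rewrite -lecR -rnormE normc_ge_Re.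
    have s0 : 0 < `|s| + 1 by rewrite ltr_wpDl.
    have -> : `|s| * (d / (4 * (`|s| + 1))) = d / 4 * (`|s| / (`|s| + 1)).
      by field; rewrite gt_eqF.
    rewrite ler_piMr ?divr_ge0 ?(ltW d0)// ler_pdivrMr// mul1r.
    by rewrite lerDl.
  rewrite ler_norml /r !cReD !cReN => /andP[+ +]; move: kd d0.
  move: (inner x z) (inner x (u k)) (phi (u k)) (phi x) => iz iu pu px.
  by move: (rnorm (u k) ^+ 2) (rnorm x ^+ 2) (k.+1%:R^-1) => U X v *; nra.
have q0 : 0 < rnorm x ^+ 2 + 1 by rewrite ltr_wpDl ?sqr_ge0.
(* The quadratic in [s] is least at [- r / q]; the denominator [q + 1] also covers [x = 0] and still
   makes the value negative unless [r = 0]. *)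
have := r_ge (- r / (rnorm x ^+ 2 + 1)).
set q := rnorm x ^+ 2 in q0 *.
have -> : (- r / (q + 1)) ^+ 2 * q + 2 * (- r / (q + 1)) * r =
  - (r ^+ 2 * ((q + 2) / (q + 1) ^+ 2)) by field; rewrite gt_eqF.
rewrite oppr_ge0 pmulr_lle0; last first.
  by rewrite divr_gt0 ?exprn_gt0//; lra.
by rewrite le_eqVlt ltNge sqr_ge0 orbF sqrf_eq0 => /eqP.
Qed.

End InnerProduct.

Section BoundedOperatorTheory.
Context {R : realType} {H : hilbertType R}.
Implicit Types (A B : bop H) (x y : H).

Lemma bounded_opI (f : H -> H) (M : R) : linear f ->
  (forall x, rnorm (f x) <= M * rnorm x) -> bounded_op f.
Proof.
move=> lf fM; apply/asboolP; split=> //.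
exact (linear_lipschitz_continuous lf fM).
Qed.

Lemma bop_bounded A :
  exists M : R, 0 <= M /\ forall x, rnorm (A x) <= M * rnorm x.
Proof.
exact: linear_continuous_lipschitz (bop_linear A) (@bop_continuous _ _ A).
Qed.

Lemma bopD A x y : A (x + y) = A x + A y.
Proof. exact: linear_funD (bop_linear A) x y. Qed.

Lemma bopZ A a x : A (a *: x) = a *: A x.
Proof. exact: linear_funZ (bop_linear A) a x. Qed.

Lemma bop0 A : A 0 = 0.
Proof. exact: linear_fun0 (bop_linear A). Qed.

Lemma bop_sum A I (r : seq I) (P : pred I) (g : I -> H) :
  A (\sum_(i <- r | P i) g i) = \sum_(i <- r | P i) A (g i).
Proof. exact: (big_morph A (bopD A) (bop0 A)). Qed.

Lemma sum_bopE I (r : seq I) (P : pred I) (A : I -> bop H) x :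
  (\sum_(i <- r | P i) A i) x = \sum_(i <- r | P i) A i x.
Proof. exact: (big_morph (fun A : bop H => A x)). Qed.

Lemma mul_bopE A B x : (A * B) x = A (B x).
Proof. by []. Qed.

Lemma cvg_bop A (u : nat -> H) x :
  u @ \oo --> x -> (fun k => A (u k)) @ \oo --> A x.
Proof.
have [M [_ AM]] := bop_bounded A.
exact (@linear_lipschitz_cvg R H H A (bop_linear A) M AM u x).
Qed.

Lemma opnorm_le A x : rnorm (A x) <= opnorm A * rnorm x.
Proof.
have [M [M0 AM]] := bop_bounded A.
have [x0|x0] := eqVneq (rnorm x) 0.
  by rewrite (rnorm_eq0 x0) bop0 !rnorm0 mulr0.
have x0' : 0 < rnorm x by rewrite lt_neqAle eq_sym x0 rnorm_ge0.
have hx y : rnorm ((rnorm x)^-1%:C *: y) = (rnorm x)^-1 * rnorm y.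
  by rewrite rnormZ cabs_real ger0_norm// invr_ge0 rnorm_ge0.
rewrite -ler_pdivrMr// mulrC -hx -bopZ; apply: ub_le_sup.
  exists M => _ [y /= y1 <-]; rewrite (le_trans (AM y))//.
  by rewrite ler_piMr.
by exists ((rnorm x)^-1%:C *: x) => //=; rewrite hx mulVf.
Qed.

Lemma opnorm_ge0 A : 0 <= opnorm A.
Proof.
have [M [M0 AM]] := bop_bounded A.
apply: (@le_trans _ _ (rnorm (A 0))); first exact: rnorm_ge0.
apply: ub_le_sup; last by exists 0 => //=; rewrite rnorm0.
exists M => _ [y /= y1 <-]; rewrite (le_trans (AM y))//.
by rewrite ler_piMr.
Qed.

Lemma adjointP A : is_adjoint A (adjoint A).
Proof.
suff [B AB] : exists B, is_adjoint A B by exact: (xgetPex _ (ex_intro _ B AB)).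
have [M [M0 AM]] := bop_bounded A.
have /choice[B AB] : forall y, exists z, forall x, inner (A x) y = inner x z.
  move=> y; apply: (@riesz _ _ (fun x => inner (A x) y) (M * rnorm y)).
    by move=> a v w; rewrite bopD bopZ innerDl innerZl.
  move=> x; rewrite (le_trans (cauchy_schwarz _ _))//.
  by rewrite mulrAC ler_wpM2r ?rnorm_ge0.
have B_lin : linear B.
  move=> a v w; apply: inner_inj => x.
  by rewrite -AB !innerDr !innerZr !AB.
have BM y : rnorm (B y) <= M * rnorm y.
  have [y0|y0] := eqVneq (rnorm (B y)) 0; first by rewrite y0 mulr_ge0 ?rnorm_ge0.
  have y0' : 0 < rnorm (B y) by rewrite lt_neqAle eq_sym y0 rnorm_ge0.
  (* One factor [|B y|] cancels from [|B y|^2 = <A (B y), y> <= M |B y| |y|]. *)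
  rewrite -(ler_pM2l y0') -expr2 rnorm_sqr -AB.
  rewrite (le_trans (cRe_le_cabs _))// (le_trans (cauchy_schwarz _ _))//.
  by rewrite mulrA (mulrC (rnorm (B y))) ler_wpM2r ?rnorm_ge0.
by exists (Bop (bounded_opI B_lin BM)) => x y; rewrite AB.
Qed.

End BoundedOperatorTheory.

(** * Words and orthonormal bases *)

Section Words.
Context {n : nat}.

(** With the words of length at most [N] in one duplicate-free list, truncations are compared by
    inclusion, and every finite set of words lies in one of them. *)
Definition wlist (N : nat) : seq (word n) :=
  flatten [seq [seq val t | t <- enum {: k.-tuple 'I_n}] | k <- iota 0 N.+1].

Lemma mem_wlist N (al : word n) : (al \in wlist N) = (size al <= N)%N.
Proof.
apply/flatten_mapP/idP => [[k]|alN].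
  rewrite mem_iota add0n ltnS => /andP[_ kN] /mapP[t _ ->].
  by rewrite size_tuple.
exists (size al); first by rewrite mem_iota.
by apply/mapP; exists (in_tuple al); rewrite ?mem_enum.
Qed.

Lemma wlist_uniq N : uniq (wlist N).
Proof.
rewrite /wlist; elim: N.+1 0%N => [|m IH] j //=.
rewrite cat_uniq IH map_inj_uniq ?enum_uniq/=; last exact: val_inj.
rewrite andbT; apply/hasPn => al /flatten_mapP[k].
rewrite mem_iota => /andP[jk _] /mapP[t _ ->].
apply/negP => /mapP[u _ /(congr1 size)].
by rewrite !size_tuple => kj; rewrite kj ltnn in jk.
Qed.

Lemma sub_wlist (s : seq (word n)) : exists N, {subset s <= wlist N}.
Proof.
exists (\max_(al <- s) size al)%N => al als.
by rewrite mem_wlist; exact: leq_bigmax_seq.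
Qed.

Lemma free_sumE {V : zmodType} (f : word n -> V) N :
  free_sum f N = \sum_(al <- wlist N) f al.
Proof.
rewrite /free_sum /wlist big_flatten big_map -[N.+1]subn0 -/(index_iota 0 _).
rewrite big_mkord subn0; apply: eq_bigr => k _.
by rewrite big_map big_enum.
Qed.

Lemma sub_big_seq {V : zmodType} {I : eqType} (s r : seq I) (f : I -> V) :
  uniq s -> uniq r -> {subset s <= r} ->
  \sum_(i <- r) f i = \sum_(i <- s) f i + \sum_(i <- r | i \notin s) f i.
Proof.
move=> us ur sr; rewrite (bigID (mem s)) /= -[in LHS]big_filter; congr (_ + _).
apply: perm_big; apply: uniq_perm; rewrite ?filter_uniq// => i.
by rewrite mem_filter /=; case: (boolP (i \in s)) => // /sr ->.
Qed.

Lemma big_seqB {V : zmodType} {I : eqType} (s r : seq I) (f : I -> V) :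
  uniq s -> uniq r -> {subset s <= r} ->
  \sum_(i <- r) f i - \sum_(i <- s) f i =
    \sum_(i <- [seq i <- r | i \notin s]) f i.
Proof.
move=> us ur sr.
by rewrite (sub_big_seq f us ur sr) addrAC subrr add0r [RHS]big_filter.
Qed.

Lemma le_sub_big_seq {R : numDomainType} {I : eqType} (s r : seq I)
    (f : I -> R) : (forall i, 0 <= f i) -> uniq s -> uniq r ->
  {subset s <= r} -> \sum_(i <- s) f i <= \sum_(i <- r) f i.
Proof.
by move=> f0 us ur sr; rewrite (sub_big_seq f us ur sr) lerDl sumr_ge0.
Qed.

End Words.

Section OrthonormalFamily.
Context {R : realType} {F : hilbertType R} {I : eqType} (e : I -> F).
Hypothesis e_on : forall i j, inner (e i) (e j) = (i == j)%:R.
Implicit Types (s : seq I) (d : I -> R[i]) (f : F).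

Lemma rnorm_on i : rnorm (e i) = 1.
Proof.
apply/eqP; rewrite -(@eqrXn2 _ 2)// ?rnorm_ge0// expr1n rnorm_sqr e_on.
by rewrite eqxx.
Qed.

Lemma inner_on_sum s d j : uniq s ->
  inner (\sum_(i <- s) d i *: e i) (e j) = if j \in s then d j else 0.
Proof.
move=> us; rewrite inner_suml.
under eq_bigr do rewrite innerZl e_on.
case: ifPn => js; last first.
  rewrite big1_seq// => i /andP[_ is_]; case: eqVneq => [ij|]; rewrite ?mulr0//.
  by rewrite -ij is_ in js.
rewrite (bigD1_seq j)//= eqxx mulr1 big1 ?addr0// => i ij.
by rewrite (negPf ij) mulr0.
Qed.

Lemma rnorm_on_sum s d : uniq s ->
  rnorm (\sum_(i <- s) d i *: e i) ^+ 2 = \sum_(i <- s) cabs (d i) ^+ 2.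
Proof.
move=> us; apply: complexI; rewrite -inner_rnorm inner_sumr rmorph_sum /=.
apply: eq_big_seq => j js.
by rewrite innerZr inner_on_sum// js mulrC mulC_conj.
Qed.

Definition on_proj s f := \sum_(i <- s) inner f (e i) *: e i.

Lemma on_proj_pythagoras s f : uniq s ->
  rnorm f ^+ 2 = rnorm (on_proj s f) ^+ 2 + rnorm (f - on_proj s f) ^+ 2.
Proof.
move=> us; have := rnorm_sqrD (on_proj s f) (f - on_proj s f).
suff -> : inner (on_proj s f) (f - on_proj s f) = 0.
  by rewrite /= mulr0 addr0 addrC subrK.
rewrite innerC /on_proj inner_sumr big1_seq ?conjC0// => j /andP[_ js].
by rewrite innerZr innerBl inner_on_sum// js subrr mulr0.
Qed.

Lemma bessel s f : uniq s ->
  \sum_(i <- s) cabs (inner f (e i)) ^+ 2 <= rnorm f ^+ 2.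
Proof.
move=> us; rewrite -rnorm_on_sum// (on_proj_pythagoras f us) lerDl.
exact: sqr_ge0.
Qed.

Lemma sub_on_proj_le s f : uniq s -> rnorm (f - on_proj s f) <= rnorm f.
Proof.
move=> us; rewrite -(@ler_pXn2r _ 2)// ?nnegrE ?rnorm_ge0//.
by rewrite (on_proj_pythagoras f us) lerDr sqr_ge0.
Qed.

Lemma on_projD s f g : on_proj s (f + g) = on_proj s f + on_proj s g.
Proof.
rewrite /on_proj -big_split /=; apply: eq_bigr => i _.
by rewrite innerDl scalerDl.
Qed.

Lemma on_projZ s a f : on_proj s (a *: f) = a *: on_proj s f.
Proof.
rewrite /on_proj scaler_sumr; apply: eq_bigr => i _.
by rewrite innerZl scalerA.
Qed.

Lemma on_projB s f g : on_proj s (f - g) = on_proj s f - on_proj s g.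
Proof. by rewrite on_projD -[in LHS]scaleN1r on_projZ scaleN1r. Qed.

Lemma on_proj_basis s i : uniq s -> i \in s -> on_proj s (e i) = e i.
Proof.
move=> us is_; rewrite /on_proj (bigD1_seq i)//= e_on eqxx scale1r big1 ?addr0//.
by move=> j ji; rewrite e_on eq_sym (negPf ji) scale0r.
Qed.

Lemma on_proj_span s r d : uniq s -> {subset r <= s} ->
  on_proj s (\sum_(i <- r) d i *: e i) = \sum_(i <- r) d i *: e i.
Proof.
move=> us; elim: r => [|i r IH] rs.
  by rewrite big_nil -(scale0r (0 : F)) on_projZ !scale0r.
rewrite big_cons on_projD on_projZ on_proj_basis ?rs ?mem_head//.
by rewrite IH// => j jr; rewrite rs// inE jr orbT.
Qed.

End OrthonormalFamily.

Section OrthonormalBasis.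
Context {R : realType} {n : nat} {F : hilbertType R} (e : word n -> F).
Hypothesis e_onb : orthonormal_basis e.
Let e_on := e_onb.1.
Implicit Types (f : F) (al : word n).

(** The projections fix a given [p] of the span from some [N] on, so the error at [f] is the error
    at [f - p], and the complementary projection does not increase norms. *)
Lemma on_proj_cvg f : (fun N => on_proj e (wlist N) f) @ \oo --> f.
Proof.
apply/cvg_seq_rnormP => d d0.
have [_ [[s [c ->]]]] := dense_rnorm f e_onb.2 d0; set p := \sum_(_ <- _) _ => fp.
have [N sN] := sub_wlist s; exists N => k Nk; apply: le_lt_trans fp.
have -> : f - on_proj e (wlist k) f =
    (f - p) - on_proj e (wlist k) (f - p).
  rewrite on_projB on_proj_span//.
  - by rewrite opprD opprK addrA addrAC subrK.
  - exact: wlist_uniq.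
  - move=> al /sN; rewrite !mem_wlist => alN; exact: leq_trans alN Nk.
exact/(sub_on_proj_le e_on)/wlist_uniq.
Qed.

(** The hypothesis says that the [x al] form a Bessel family with bound [C ^+ 2]. Differences of
    partial sums are again finite sums, hence controlled by the expansion of [f], which is Cauchy.
    The explicit limit is kept in the conclusion because later estimates are made on the partial
    sums. *)
Lemma basis_extension {V : hilbertType R} (x : word n -> V) (C : R) :
  (forall s (d : word n -> R[i]), uniq s ->
     rnorm (\sum_(al <- s) d al *: x al) ^+ 2 <=
       C ^+ 2 * \sum_(al <- s) cabs (d al) ^+ 2) -> 0 <= C ->
  exists G : F -> V, [/\ linear G,
    forall f, rnorm (G f) <= C * rnorm f,
    forall f, (fun N => \sum_(al <- wlist N) inner f (e al) *: x al) @ \oo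
      --> G f &
    forall al, G (e al) = x al].
Proof.
move=> xC C0; pose g f N := \sum_(al <- wlist N) inner f (e al) *: x al.
have g_cauchy f (j k : nat) : (j <= k)%N -> rnorm (g f k - g f j) <=
    C * rnorm (on_proj e (wlist k) f - on_proj e (wlist j) f).
  move=> jk; have jk_sub : {subset wlist (n := n) j <= wlist k}.
    by move=> al; rewrite !mem_wlist => /leq_trans; exact.
  rewrite /g /on_proj !(big_seqB _ (wlist_uniq j) (wlist_uniq k) jk_sub).
  rewrite -(@ler_pXn2r _ 2)// ?nnegrE ?mulr_ge0 ?rnorm_ge0// exprMn.
  have uk := filter_uniq (fun al => al \notin wlist j) (wlist_uniq (n := n) k).
  by rewrite (rnorm_on_sum e_on _ uk) xC.
have /choice[G gG] : forall f, exists y : V, g f @ \oo --> y.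
  move=> f; apply: cauchy_rnorm_cvg => d d0.
  have C1 : 0 < C + 1 by rewrite ltr_wpDl.
  have /cvg_seq_rnormP /(_ (d / (2 * (C + 1)))) := @on_proj_cvg f.
  rewrite divr_gt0 ?mulr_gt0// => /(_ isT)[N hN]; exists N.
  suff hjk (j k : nat) : (N <= j)%N -> (j <= k)%N -> rnorm (g f k - g f j) < d.
    move=> j k Nj Nk; have [jk|/ltnW kj] := leqP j k; last exact: hjk.
    by rewrite rnormB_sym hjk.
  move=> Nj jk; apply: le_lt_trans (g_cauchy f j k jk) _.
  have := rnormB_triangle f (on_proj e (wlist k) f) (on_proj e (wlist j) f).
  have := hN _ Nj; have := hN _ (leq_trans Nj jk); rewrite rnormB_sym.
  have := rnorm_ge0 (on_proj e (wlist k) f - on_proj e (wlist j) f).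
  move: (rnorm (on_proj e (wlist k) f - f)) (rnorm (f - _)) (rnorm _) => a b c.
  rewrite !ltr_pdivlMr ?mulr_gt0// => c0 h1 h2 h3.
  have : C * c <= C * (a + b) by rewrite ler_wpM2l.
  nra.
exists G; split=> [a f h|f|f|al]; last 2 first.
- exact: gG.
- apply: (cvg_seq_unique (gG (e al))); apply: (@cvg_eventually_cst _ _ _ _ (size al)).
  move=> k alk; rewrite /g (bigD1_seq al) ?mem_wlist ?wlist_uniq//=.
  rewrite e_on eqxx scale1r big1 ?addr0// => be neq.
  by rewrite e_on eq_sym (negPf neq) scale0r.
- apply: (cvg_seq_unique (gG _)).
  have -> : g (a *: f + h) = fun N => a *: g f N + g h N.
    apply/funext => N; rewrite /g scaler_sumr -big_split /=.
    by apply: eq_bigr => al _; rewrite innerDl innerZl scalerDl scalerA.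
  by apply: cvg_seqD; [apply: cvg_seqZ|]; exact: gG.
- apply: (cvg_rnorm_le (gG f)) => N.
  rewrite -(@ler_pXn2r _ 2)// ?nnegrE ?mulr_ge0 ?rnorm_ge0// exprMn.
  rewrite (le_trans (xC _ _ (wlist_uniq N)))// ler_wpM2l ?sqr_ge0//.
  exact/bessel/wlist_uniq.
Qed.

(** Stated for functions because the maps compared later go from [F] to [H], whereas a [bop] maps a
    space to itself. *)
Lemma bop_eq_basis {V : hilbertType R} (A B : F -> V) (M N : R) :
  linear A -> linear B -> (forall f, rnorm (A f) <= M * rnorm f) ->
  (forall f, rnorm (B f) <= N * rnorm f) ->
  (forall al, A (e al) = B (e al)) -> A =1 B.
Proof.
move=> lA lB AM BN AB f.
have cA := linear_lipschitz_cvg lA AM (@on_proj_cvg f).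
have cB := linear_lipschitz_cvg lB BN (@on_proj_cvg f).
apply: (cvg_seq_unique cA); apply: cvg_seq_ext cB => k; rewrite /on_proj (linear_fun_sum lA) (linear_fun_sum lB).
by apply: eq_bigr => al _; rewrite (linear_funZ lA) (linear_funZ lB) AB.
Qed.

End OrthonormalBasis.

(** * The Poisson kernel *)

(** The family is a function on [nat], orthonormal below [m], so that appending a vector only
    changes the value at [m]. *)
Lemma gram_schmidt {R : realType} {H : hilbertType R} (s : seq H) :
  exists m (u : nat -> H),
    (forall i j : 'I_m, inner (u i) (u j) = (i == j)%:R) /\
    (forall x, x \in s -> exists a : nat -> R[i], x = \sum_(l < m) a l *: u l).
Proof.
elim: s => [|x s [m [u [u_on us]]]]; first by exists 0%N, (fun=> 0); split=> [[]|].
have u_uniq : uniq (index_enum 'I_m) by exact: index_enum_uniq.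
pose p := on_proj (fun i : 'I_m => u i) (index_enum 'I_m) x.
have [r0|r_neq0] := eqVneq (rnorm (x - p)) 0.
  exists m, u; split=> // y; rewrite inE => /predU1P[->|/us//].
  exists (fun l => inner x (u l)); rewrite -[LHS](subrK p).
  by rewrite (rnorm_eq0 r0) add0r.
pose v : H := ((rnorm (x - p))^-1)%:C *: (x - p).
have vE : x = (rnorm (x - p))%:C *: v + p.
  by rewrite scalerA -rmorphM /= mulfV// scale1r subrK.
have u_v (i : 'I_m) : inner (u i) v = 0.
  rewrite innerZr innerBr [inner _ p]innerC.
  rewrite (@inner_on_sum _ _ _ (fun i : 'I_m => u i) u_on _
    (fun i : 'I_m => inner x (u i)) i)//.
  by rewrite mem_index_enum -innerC subrr mulr0.
have v_v : inner v v = 1.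
  rewrite inner_rnorm rnormZ cabs_real ger0_norm ?invr_ge0 ?rnorm_ge0//.
  by rewrite mulVf// expr1n.
exists m.+1, (fun l => if l == m then v else u l); split=> [i j|y].
  have lt_m (k : 'I_m.+1) : k != m :> nat -> (k < m)%N.
    by move=> km; rewrite ltn_neqAle km -ltnS ltn_ord.
  have [im|im] := eqVneq (i : nat) m; have [jm|jm] := eqVneq (j : nat) m.
  - by rewrite v_v -val_eqE /= im jm eqxx.
  - rewrite innerC (u_v (Ordinal (lt_m _ jm))) conjC0.
    by rewrite -val_eqE /= im eq_sym (negPf jm).
  - by rewrite (u_v (Ordinal (lt_m _ im))) -val_eqE /= jm (negPf im).
  - by rewrite (u_on (Ordinal (lt_m _ im)) (Ordinal (lt_m _ jm))).
have u_sum (a : nat -> R[i]) (b : R[i]) :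
    \sum_(l < m.+1) (if l == m :> nat then b else a l) *:
      (if l == m :> nat then v else u l) = \sum_(l < m) a l *: u l + b *: v.
  rewrite big_ord_recr /= eqxx; congr (_ + _); apply: eq_bigr => l _.
  by rewrite ltn_eqF.
rewrite inE => /predU1P[->|/us[a ->]].
  exists (fun l => if l == m then (rnorm (x - p))%:C else inner x (u l)).
  by rewrite [RHS](u_sum (fun l => inner x (u l))) addrC -vE.
exists (fun l => if l == m then 0 else a l).
by rewrite [RHS]u_sum scale0r addr0.
Qed.

Section MatrixNorm.
Context {R : realType} {K : hilbertType R} {k : nat}.
Implicit Types (M : 'M[bop K]_k) (v w : 'I_k -> K).

Lemma le_mxop_norm M v : \sum_j rnorm (v j) ^+ 2 <= 1 ->
  Num.sqrt (\sum_i rnorm (\sum_j M i j (v j)) ^+ 2) <= mxop_norm M.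
Proof.
move=> v_le1; apply: ub_le_sup; last by exists v.
(* A crude bound by operator norms: the [sup] dominates the members only if the set is bounded
   above. *)
exists (Num.sqrt (\sum_i (\sum_j opnorm (M i j)) ^+ 2)) => _ [w /= w1 <-].
rewrite ler_wsqrtr// ler_sum// => i _.
rewrite ler_pXn2r// ?nnegrE ?rnorm_ge0//; last first.
  by apply: sumr_ge0 => j _; exact: opnorm_ge0.
rewrite (le_trans (rnorm_sum _ _ _))// ler_sum// => j _.
rewrite (le_trans (opnorm_le _ _))// ler_piMr ?opnorm_ge0//.
rewrite -(@ler_pXn2r _ 2)// ?nnegrE ?rnorm_ge0// expr1n.
apply: le_trans w1; rewrite (bigD1 j)//= lerDl.
by apply: sumr_ge0 => l _; exact: sqr_ge0.
Qed.

Lemma mxop_norm_ge0 M : 0 <= mxop_norm M.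
Proof.
apply: le_trans (sqrtr_ge0 _) (@le_mxop_norm M (fun=> 0) _).
by rewrite big1 ?ler01// => j _; rewrite rnorm0 expr0n.
Qed.

Lemma mxop_norm_le M w :
  \sum_i rnorm (\sum_j M i j (w j)) ^+ 2 <=
    mxop_norm M ^+ 2 * \sum_j rnorm (w j) ^+ 2.
Proof.
have sum_ge0 v : 0 <= \sum_j rnorm (v j) ^+ 2.
  by apply: sumr_ge0 => j _; exact: sqr_ge0.
pose t := Num.sqrt (\sum_j rnorm (w j) ^+ 2).
have t2 : t ^+ 2 = \sum_j rnorm (w j) ^+ 2 by rewrite sqr_sqrtr.
have [t0|t_neq0] := eqVneq t 0.
  have w0 j : w j = 0.
    apply: rnorm_eq0; apply/eqP; rewrite -sqrf_eq0.
    move: t2; rewrite t0 expr0n /= => /esym/eqP.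
    rewrite psumr_eq0; last by move=> i _; exact: sqr_ge0.
    by move=> /allP /(_ j (mem_index_enum _)).
  rewrite big1; first by rewrite mulr_ge0 ?sqr_ge0.
  by move=> i _; rewrite big1 ?rnorm0 ?expr0n// => j _; rewrite w0 bop0.
have t_gt0 : 0 < t by rewrite lt_neqAle eq_sym t_neq0 sqrtr_ge0.
have rt x : rnorm ((t^-1)%:C *: x : K) = t^-1 * rnorm x.
  by rewrite rnormZ cabs_real gtr0_norm// invr_gt0.
have Ew : \sum_i rnorm (\sum_j M i j (w j)) ^+ 2 = t ^+ 2 *
    \sum_i rnorm (\sum_j M i j ((t^-1)%:C *: w j)) ^+ 2.
  rewrite mulr_sumr; apply: eq_bigr => i _.
  under [in RHS]eq_bigr do rewrite bopZ.
  by rewrite -scaler_sumr rt exprMn mulrA -exprMn mulfV// expr1n mul1r.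
rewrite Ew -t2 mulrC ler_wpM2r ?sqr_ge0//.
set q := \sum_i _; have q0 : 0 <= q by apply: sumr_ge0 => i _; exact: sqr_ge0.
suff qM : Num.sqrt q <= mxop_norm M.
  by rewrite -(sqr_sqrtr q0) ler_pXn2r// nnegrE ?sqrtr_ge0 ?mxop_norm_ge0.
apply: (@le_mxop_norm M (fun j => (t^-1)%:C *: w j)).
under eq_bigr do rewrite rt exprMn.
by rewrite -mulr_sumr -t2 -exprMn mulVf// expr1n.
Qed.

Lemma mxop_norm_bound M (C : R) : 0 <= C ->
  (forall v, \sum_j rnorm (v j) ^+ 2 <= 1 ->
     \sum_i rnorm (\sum_j M i j (v j)) ^+ 2 <= C ^+ 2) ->
  mxop_norm M <= C.
Proof.
move=> C0 MC; apply: ge_sup.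
  exists (Num.sqrt (\sum_i rnorm (\sum_j M i j 0) ^+ 2)), (fun=> 0) => //=.
  by rewrite big1 ?ler01// => j _; rewrite rnorm0 expr0n.
move=> _ [v /= v1 <-]; rewrite -[leRHS](ger0_norm C0) -sqrtr_sqr.
by rewrite ler_wsqrtr// MC.
Qed.

End MatrixNorm.

(** * The row operator with entries [T_al / bmu al] *)

Section RowContraction.
Context {R : realType} {n : nat} {mu : word n -> R} {H : hilbertType R}.
Context {T : 'I_n -> bop H} {S : bop H}.
Hypothesis mu_gt0 : forall al, 0 < mu al.
Hypothesis TS : dmu_sum mu T S.
Implicit Types (al : word n) (x y : H).

Lemma bmu_gt0 al : 0 < bmu mu al.
Proof. by elim: al => [|i al IH] /=; rewrite ?ltr01// mulr_gt0. Qed.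

Let inner_dmu_term al y :
  inner ((((bmu mu al) ^- 2)%:C *:
    (opword T al * adjoint (opword T al)) : bop H) y) y =
  ((bmu mu al) ^- 2 * rnorm (adjoint (opword T al) y) ^+ 2)%:C.
Proof.
rewrite -[X in inner X _]/(_ *: opword T al (adjoint (opword T al) y)).
by rewrite innerZl adjointP inner_rnorm -rmorphM.
Qed.

(** Paired with [y], the terms of the series for [S] are nonnegative, so every finite sum is at most
    the limit [inner (S y) y]. This is the bound for finitely many coordinates of [K]. *)
Lemma dmu_sum_ge (s : seq (word n)) y : uniq s ->
  \sum_(al <- s) (bmu mu al) ^- 2 * rnorm (adjoint (opword T al) y) ^+ 2 <=
    opnorm S * rnorm y ^+ 2.
Proof.
move=> us; pose f al := (bmu mu al) ^- 2 * rnorm (adjoint (opword T al) y) ^+ 2.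
have f0 al : 0 <= f al by rewrite mulr_ge0 ?invr_ge0 ?sqr_ge0.
apply: (@le_trans _ _ (complex.Re (inner (S y) y))); last first.
  rewrite (le_trans (cRe_le_cabs _))// (le_trans (cauchy_schwarz _ _))//.
  by rewrite expr2 mulrA ler_wpM2r ?rnorm_ge0 ?opnorm_le.
apply/ler_addgt0Pl => d d0.
have /wot_cvgP /(_ y y) /cvg_seq_rnormP /(_ d d0) [N hN] := TS.
have [N' sN'] := sub_wlist s.
have := hN _ (leq_maxl N N'); set k := maxn N N'.
rewrite free_sumE sum_bopE inner_suml.
under eq_bigr do rewrite inner_dmu_term.
rewrite -rmorph_sum /= => Sk.
apply: (@le_trans _ _ (\sum_(al <- wlist k) f al)).
  apply: le_sub_big_seq => //; first exact: wlist_uniq.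
  move=> al /sN'; rewrite !mem_wlist => /leq_trans; apply; exact: leq_maxr.
rewrite -lerBlDr; apply: le_trans (ltW Sk); rewrite -[rnorm _]cabsN opprB.
by apply: le_trans (cRe_le_cabs _); rewrite cReD cReN.
Qed.

(** The norm estimate is asserted for every sum of the series, whereas [G] is built from a chosen
    one. *)
Lemma dmu_sum_unique (S' : bop H) : dmu_sum mu T S' -> S = S'.
Proof.
move=> TS'; apply: bopP => x; apply: inner_inj => y.
rewrite innerC [RHS]innerC; congr (Num.conj _).
have /wot_cvgP /(_ x y) c1 := TS; have /wot_cvgP /(_ x y) c2 := TS'.
exact: (@cvg_seq_unique _ R[i]^o _ _ _ c1 c2).
Qed.

(** Dual to [dmu_sum_ge]: the vector [y] is paired with itself, the operators move to the other side
    as adjoints, and [dmu_sum_ge] bounds their values at [y]. *)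
Lemma row_bound (s : seq (word n)) (h : word n -> H) : uniq s ->
  rnorm (\sum_(al <- s) ((bmu mu al)^-1)%:C *: opword T al (h al)) ^+ 2 <=
    opnorm S * \sum_(al <- s) rnorm (h al) ^+ 2.
Proof.
move=> us; set y := \sum_(al <- s) _; set A := \sum_(al <- s) _.
have A0 : 0 <= A by apply: sumr_ge0 => al _; exact: sqr_ge0.
have S0 := opnorm_ge0 S.
(* AM-GM below divides by [K], so [opnorm S] is replaced by a positive upper bound; when
   [opnorm S = 0], the choice [K = d / (A + 1)] makes the right-hand side at most [d]. *)
suff hK (K : R) : 0 < K -> opnorm S <= K -> rnorm y ^+ 2 <= K * A.
  move: S0; rewrite le_eqVlt => /predU1P[S0|/hK]; last exact.
  rewrite -S0 mul0r; apply/ler_addgt0Pl => d d0; rewrite addr0.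
  have A1 : 0 < A + 1 by rewrite ltr_wpDl.
  apply: le_trans (hK (d / (A + 1)) _ _) _;
    rewrite -?S0 ?divr_ge0 ?divr_gt0 ?(ltW d0) ?(ltW A1)//.
  by rewrite mulrAC ler_pdivrMr// ler_wpM2l ?(ltW d0)// lerDl.
move=> K0 SK.
pose b al := (bmu mu al)^-1 * rnorm (adjoint (opword T al) y).
have yE : rnorm y ^+ 2 <= \sum_(al <- s) rnorm (h al) * b al.
  rewrite rnorm_sqr {1}/y inner_suml.
  rewrite (big_morph _ cReD (erefl : complex.Re 0 = 0 :> R)) ler_sum// => al _.
  rewrite innerZl adjointP cReZ mulrCA ler_wpM2l ?invr_ge0 ?(ltW (bmu_gt0 _))//.
  by rewrite (le_trans (cRe_le_cabs _))// cauchy_schwarz.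
have b2 : \sum_(al <- s) b al ^+ 2 <= K * rnorm y ^+ 2.
  apply: le_trans (ler_wpM2r (sqr_ge0 _) SK).
  apply: le_trans (dmu_sum_ge y us); rewrite ler_sum// => al _.
  by rewrite exprMn exprVn.
(* AM-GM: [2 a b <= K a^2 + b^2 / K] *)
have ab : 2 * \sum_(al <- s) rnorm (h al) * b al <=
    K * A + K^-1 * \sum_(al <- s) b al ^+ 2.
  rewrite !mulr_sumr -big_split /= ler_sum// => al _.
  rewrite -subr_ge0.
  have -> : K * rnorm (h al) ^+ 2 + K^-1 * b al ^+ 2 -
      2 * (rnorm (h al) * b al) = K^-1 * (K * rnorm (h al) - b al) ^+ 2.
    by field; rewrite gt_eqF.
  by rewrite mulr_ge0 ?sqr_ge0 ?invr_ge0 ?(ltW K0).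
(* Altogether [2 |y|^2 <= K A + |y|^2]. *)
have : K^-1 * \sum_(al <- s) b al ^+ 2 <= rnorm y ^+ 2.
  by rewrite mulrC ler_pdivrMr// mulrC.
lra.
Qed.

End RowContraction.

Lemma scaler_swap {K : comPzRingType} {V : lmodType K} (a b : K) (v : V) :
  a *: (b *: v) = b *: (a *: v).
Proof. by rewrite !scalerA mulrC. Qed.

Section Synthesis.
Context {R : realType} {n : nat} {mu : word n -> R}.
Context {F : hilbertType R} {e : word n -> F} {H : hilbertType R}.
Context {T : 'I_n -> bop H} {S : bop H}.
Hypothesis mu_gt0 : forall al, 0 < mu al.
Hypothesis e_onb : orthonormal_basis e.
Hypothesis TS : dmu_sum mu T S.

(* [G f h] is [K^* (f (x) h)], with [K] the Poisson kernel. *)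
Definition is_synthesis (G : F -> bop H) : Prop :=
  [/\ linear G,
      forall f h, rnorm (G f h) <= Num.sqrt (opnorm S) * rnorm f * rnorm h,
      forall f h, (fun N => \sum_(al <- wlist N)
        inner f (e al) *: (((bmu mu al)^-1)%:C *: opword T al h)) @ \oo
        --> G f h &
      forall al, G (e al) = ((bmu mu al)^-1)%:C *: opword T al].

Lemma synthesis_exists : exists G, is_synthesis G.
Proof.
pose C := Num.sqrt (opnorm S).
pose x h al := ((bmu mu al)^-1)%:C *: opword T al h.
have C2 : C ^+ 2 = opnorm S by rewrite sqr_sqrtr ?opnorm_ge0.
have /choice[G0 G0P] : forall h, exists G : F -> H, [/\ linear G,
    forall f, rnorm (G f) <= C * rnorm h * rnorm f,
    forall f, (fun N => \sum_(al <- wlist N) inner f (e al) *: x h al) @ \oo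
      --> G f &
    forall al, G (e al) = x h al].
  move=> h; apply: basis_extension; rewrite ?mulr_ge0 ?rnorm_ge0 ?sqrtr_ge0//.
  (* [row_bound] at the vectors [d al *: h] is the source of the constant [C * rnorm h]. *)
  move=> s d us; rewrite /x; have := row_bound mu_gt0 TS (fun al => d al *: h) us.
  under [X in rnorm X]eq_bigr do rewrite bopZ scaler_swap.
  under [X in _ * X]eq_bigr do rewrite rnormZ exprMn.
  by rewrite -mulr_suml exprMn C2 (mulrC _ (rnorm h ^+ 2)) mulrA.
(* [G0] was chosen separately for each [h]; linearity in [h] comes from the limit formula, which
   determines its values. *)
have G0_lin f : linear (fun h => G0 h f).
  move=> a h k.
  have [_ _ c0 _] := G0P (a *: h + k).
  have [_ _ c1 _] := G0P h; have [_ _ c2 _] := G0P k.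
  apply: (cvg_seq_unique (@c0 f)).
  refine (cvg_seq_ext _ (cvg_seqD (cvg_seqZ (a := a) (@c1 f)) (@c2 f))) => N.
  rewrite scaler_sumr -big_split /=; apply: eq_bigr => al _.
  rewrite /x bopD bopZ !scalerDr !scalerA; congr (_ *: _ + _).
  by ring.
have /choice[G GE] : forall f, exists B : bop H, forall h, B h = G0 h f.
  move=> f; have fM h : rnorm (G0 h f) <= C * rnorm f * rnorm h.
    by have [_ /(_ f)] := G0P h; rewrite mulrAC.
  by exists (Bop (bounded_opI (G0_lin f) fM)).
exists G; split=> [a f g|f h|f h|al].
- apply: bopP => h; rewrite GE.
  rewrite -[RHS]/(a *: G f h + G g h) !GE.
  by have [l _ _ _] := G0P h; exact: l.
- by rewrite GE; have [_ l _ _] := G0P h; rewrite mulrAC.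
- by rewrite GE; have [_ _ l _] := G0P h.
- apply: bopP => h; rewrite GE; have [_ _ _ ->] := G0P h.
  by [].
Qed.

End Synthesis.

Section SynthesisTheory.
Context {R : realType} {n : nat} {mu : word n -> R}.
Context {F : hilbertType R} {e : word n -> F} {H : hilbertType R}.
Context {T : 'I_n -> bop H} {S : bop H} {G : F -> bop H}.
Hypothesis mu_gt0 : forall al, 0 < mu al.
Hypothesis e_onb : orthonormal_basis e.
Hypothesis G_synth : is_synthesis (mu := mu) (e := e) (T := T) (S := S) G.
Let e_on := e_onb.1.

Lemma synthesis_linear h : linear (fun f => G f h).
Proof. by have [l _ _ _] := G_synth => a f g; rewrite l. Qed.

Lemma synthesis_le f h :
  rnorm (G f h) <= Num.sqrt (opnorm S) * rnorm h * rnorm f.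
Proof. by have [_ l _ _] := G_synth; rewrite mulrAC. Qed.

Lemma synthesis_cvg (u : nat -> F) f h :
  u @ \oo --> f -> (fun k => G (u k) h) @ \oo --> G f h.
Proof.
exact (@linear_lipschitz_cvg _ _ _ _ (synthesis_linear h) _
  (fun f => synthesis_le f h) u f).
Qed.

Lemma synthesisZ a f : G (a *: f) = a *: G f.
Proof.
have [l _ _ _] := G_synth.
have G0 : G 0 = 0 by have := l (-1) 0 0; rewrite scaler0 addr0 scaleN1r addNr.
by have := l a f 0; rewrite G0 !addr0.
Qed.

Lemma synthesis_sum (I : Type) (r : seq I) (d : I -> R[i]) (f : I -> F) :
  G (\sum_(i <- r) d i *: f i) = \sum_(i <- r) d i *: G (f i).
Proof.
have [l _ _ _] := G_synth.
have G0 : G 0 = 0 by have := l (-1) 0 0; rewrite scaler0 addr0 scaleN1r addNr.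
by elim/big_rec2: _ => // i B f' _ <-; rewrite l.
Qed.

(* With [v_j = sum_l a_jl u_l] for an orthonormal family [u], the bound for the
   matrix [Psi(M_ij)] at [v] reduces, by Bessel's inequality in [F], to the
   bounds for [M] at the vectors [(a_jl e_0)_j]. *)
Lemma synthesis_mxop_norm (TS : dmu_sum mu T S) k (M : 'M[bop F]_k) f0 :
  rnorm f0 = 1 -> mxop_norm M <= 1 ->
  mxop_norm (map_mx (fun A : bop F => G (A f0)) M) <= Num.sqrt (opnorm S).
Proof.
move=> f01 M1; have [_ _ G_cvg _] := G_synth.
have S0 := opnorm_ge0 S.
apply: mxop_norm_bound => [|v v1]; first exact: sqrtr_ge0.
rewrite sqr_sqrtr//.
have [m [u [u_on us]]] := gram_schmidt [seq v j | j <- enum 'I_k].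
have /choice[a va] : forall j, exists a : nat -> R[i],
    v j = \sum_(l < m) a l *: u l.
  by move=> j; apply: us; apply/mapP; exists j; rewrite ?mem_enum.
have um_uniq : uniq (index_enum 'I_m) by exact: index_enum_uniq.
(* Coordinates split a norm in [H] into scalar squares, so that the sums over [al] can be treated
   for each [l] separately. *)
have v_norm (c : 'I_k -> R[i]) : rnorm (\sum_j c j *: v j) ^+ 2 =
    \sum_(l < m) cabs (\sum_j c j * a j l) ^+ 2.
  rewrite -(rnorm_on_sum u_on (fun l => \sum_j c j * a j l) um_uniq).
  congr (rnorm _ ^+ 2); under [RHS]eq_bigr do rewrite scaler_suml.
  rewrite exchange_big; apply: eq_bigr => j _ /=.
  by rewrite va scaler_sumr; apply: eq_bigr => l _; rewrite scalerA.
pose w l j := a j l *: f0.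
pose B i := \sum_(l < m) rnorm (\sum_j M i j (w l j)) ^+ 2.
have row_le i : rnorm (\sum_j G (M i j f0) (v j)) ^+ 2 <= opnorm S * B i.
  have B0 : 0 <= B i by apply: sumr_ge0 => l _; exact: sqr_ge0.
  rewrite -[leRHS]sqr_sqrtr ?mulr_ge0// ler_pXn2r ?nnegrE ?rnorm_ge0 ?sqrtr_ge0//.
  (* The bound is proved for the partial sums: they have the form required by [row_bound], with
     vectors [h al] combining the [v j], and Bessel then applies for each coordinate [l]. *)
  apply: cvg_rnorm_le; first by apply: cvg_seq_sum => j; exact: G_cvg.
  move=> N /=; rewrite -(@ler_pXn2r _ 2) ?nnegrE ?rnorm_ge0 ?sqrtr_ge0//.
  rewrite sqr_sqrtr ?mulr_ge0// exchange_big /=.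
  pose h al := \sum_j inner (M i j f0) (e al) *: v j.
  have := row_bound mu_gt0 TS h (wlist_uniq N).
  rewrite (_ : \sum_(al <- _) _ *: opword T al (h al) = \sum_(al <- wlist N)
      \sum_j inner (M i j f0) (e al) *:
        (((bmu mu al)^-1)%:C *: opword T al (v j))).
    move=> /le_trans; apply; rewrite ler_wpM2l//.
    under eq_bigr do rewrite v_norm.
    rewrite exchange_big /= ler_sum// => l _.
    apply: le_trans (bessel e_on _ (wlist_uniq N)).
    rewrite ler_sum// => al _; rewrite inner_suml.
    under [X in _ <= cabs X ^+ 2]eq_bigr do rewrite bopZ innerZl mulrC.
    by [].
  apply: eq_bigr => al _; rewrite bop_sum scaler_sumr.
  by apply: eq_bigr => j _; rewrite bopZ scaler_swap.
under eq_bigr do under eq_bigr do rewrite mxE.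
apply: le_trans (ler_sum _ (fun i _ => row_le i)) _.
rewrite -mulr_sumr -[leRHS]mulr1 ler_wpM2l// /B exchange_big /=.
apply: le_trans v1.
apply: (@le_trans _ _
  (\sum_(l < m) mxop_norm M ^+ 2 * \sum_j rnorm (w l j) ^+ 2)).
  by apply: ler_sum => l _; exact: mxop_norm_le.
rewrite -mulr_sumr.
apply: (@le_trans _ _ (1 * \sum_(l < m) \sum_j rnorm (w l j) ^+ 2)).
  apply: ler_wpM2r; last by rewrite expr_le1 ?mxop_norm_ge0.
  by apply: sumr_ge0 => l _; apply: sumr_ge0 => j _; exact: sqr_ge0.
(* As [f0] is a unit vector, the squared norms of the [w l j] add up over [l] to that of [v j]. *)
rewrite mul1r exchange_big /= ler_sum// => j _.
rewrite [X in _ <= rnorm X ^+ 2]va (rnorm_on_sum u_on _ um_uniq).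
by rewrite ler_sum// => l _; rewrite rnormZ f01 mulr1.
Qed.

End SynthesisTheory.

(** * Shifts and the Hardy algebra *)

Section FreePolynomials.
Context {R : realType} {n : nat} {H : hilbertType R} (T : 'I_n -> bop H).

Lemma opword_cat al be : opword T (al ++ be) = opword T al * opword T be.
Proof. by rewrite /opword big_cat. Qed.

Lemma free_poly_sum c N :
  free_poly T c N = \sum_(al <- wlist N) c al *: opword T al.
Proof. exact: free_sumE. Qed.

Lemma free_polyE c N x :
  free_poly T c N x = \sum_(al <- wlist N) c al *: opword T al x.
Proof. by rewrite free_poly_sum sum_bopE. Qed.

Lemma comm_free_poly (B : bop H) c N :
  (forall i, T i * B = B * T i) -> free_poly T c N * B = B * free_poly T c N.
Proof.
move=> TB; have TBw al : opword T al * B = B * opword T al.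
  rewrite /opword; elim: al => [|i al IH]; first by rewrite big_nil mul1r mulr1.
  by rewrite big_cons -mulrA IH !mulrA TB.
apply: bopP => x; rewrite !mul_bopE !free_polyE bop_sum.
by apply: eq_bigr => al _; rewrite bopZ -!mul_bopE TBw.
Qed.

End FreePolynomials.

(** * The commutant of the weighted right shifts, and Fejer means *)

Section Shifts.
Context {R : realType} {n : nat} {mu : word n -> R}.
Context {F : hilbertType R} {e : word n -> F} {W : 'I_n -> bop F}.
Hypothesis mu_adm : admissible_weights mu.
Hypothesis e_onb : orthonormal_basis e.
Hypothesis W_shift : weighted_left_shift e W mu.
Implicit Types (al be : word n) (c : word n -> R[i]) (A B : bop F).

Let e_on := e_onb.1.

Let mu_gt0 al : 0 < mu al. Proof. by have [_ + _ _] := mu_adm. Qed.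

Let bmu_gt0 al : 0 < bmu mu al. Proof. exact: bmu_gt0. Qed.

Let bmuC_neq0 al : (bmu mu al)%:C != 0 :> R[i].
Proof. by rewrite gt_eqF// ltcR. Qed.

Lemma bop_eq A B : (forall al, A (e al) = B (e al)) -> A = B.
Proof.
move=> AB; apply: bopP.
have [M [_ AM]] := bop_bounded A; have [N [_ BN]] := bop_bounded B.
exact: (bop_eq_basis e_onb (bop_linear A) (bop_linear B) AM BN AB).
Qed.

Lemma opword_shift al be :
  opword W al (e be) = (bmu mu (al ++ be) / bmu mu be)%:C *: e (al ++ be).
Proof.
rewrite /opword; elim: al => [|i al IH].
  by rewrite big_nil /= divff ?gt_eqF// scale1r.
rewrite big_cons mul_bopE IH bopZ W_shift scalerA -rmorphM /= mulrC.
by rewrite mulrA.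
Qed.

Lemma opword_shift0 al : opword W al (e [::]) = (bmu mu al)%:C *: e al.
Proof. by rewrite opword_shift cats0 /= divr1. Qed.

(** The second supremum condition on the weights is the boundedness of these ratios, and the vectors
    [e (rcons al i)] are again orthonormal. *)
Lemma right_shift_exists i : exists B : bop F, forall al,
  B (e al) = (bmu mu (rcons al i) / bmu mu al)%:C *: e (rcons al i).
Proof.
have [_ _ _ /(_ i)[C ubC]] := mu_adm.
pose r al := bmu mu (rcons al i) / bmu mu al.
have r0 al : 0 < r al by rewrite divr_gt0.
have rC al : r al <= C by apply: ubC; exists al.
have C0 : 0 <= C by apply: le_trans (rC [::]); exact: ltW.
have e'_on al be : inner (e (rcons al i)) (e (rcons be i)) = (al == be)%:R.
  by rewrite e_on eqseq_rcons eqxx andbT.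
have [s d us||G [G_lin G_le _ Ge]] := @basis_extension _ _ _ _ e_onb F
    (fun al => (r al)%:C *: e (rcons al i)) C; last 2 first.
- exact: C0.
- by exists (Bop (bounded_opI G_lin G_le)) => al; exact: Ge.
under eq_bigr do rewrite scalerA.
rewrite (rnorm_on_sum e'_on _ us) mulr_sumr ler_sum// => al _.
rewrite cabsM cabs_real gtr0_norm// exprMn mulrC ler_wpM2r ?sqr_ge0//.
by rewrite ler_pXn2r// nnegrE// ltW.
Qed.

(** The weights are those for which left and right shifts commute: in either order, [e al] goes to
    the basis vector of the word [j al i] with the coefficient [bmu (j al i) / bmu al]. *)
Definition is_right_shift (B : 'I_n -> bop F) : Prop := forall i al,
  B i (e al) = (bmu mu (rcons al i) / bmu mu al)%:C *: e (rcons al i).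

Lemma right_shifts_exist : exists B : 'I_n -> bop F, is_right_shift B.
Proof. by have /choice[B BE] := right_shift_exists; exists B. Qed.

Section Commutant.
Variable B : 'I_n -> bop F.
Hypothesis B_shift : is_right_shift B.

Lemma shifts_commute i j : W j * B i = B i * W j.
Proof.
apply: bop_eq => al; rewrite !mul_bopE B_shift W_shift !bopZ B_shift W_shift.
rewrite !scalerA -!rmorphM /=; congr (_%:C *: _).
by field; rewrite !gt_eqF.
Qed.

(** Convergence on the basis passes to finite combinations, and the bound required of a multiplier
    is then that of the given [A]. *)
Lemma fourier_repI A c :
  (forall al, (fun N => free_poly W c N (e al)) @ \oo --> A (e al)) ->
  fourier_rep e W A c.
Proof.
move=> Ac.
have Acp p : lspan e p -> (fun N => free_poly W c N p) @ \oo --> A p.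
  move=> [s [d ->]]; rewrite bop_sum.
  have -> : (fun N => free_poly W c N (\sum_(al <- s) d al *: e al)) =
      fun N => \sum_(al <- s) free_poly W c N (d al *: e al).
    by apply/funext => N; rewrite bop_sum.
  apply: cvg_seq_sum => al; rewrite bopZ.
  under [X in X @ _]funext do rewrite bopZ.
  by apply: cvg_seqZ; exact: Ac.
have limE p : lspan e p -> limn (fun N => free_poly W c N p) = A p.
  by move=> /Acp; exact: (cvg_lim (@norm_hausdorff _ F)).
split; last by move=> p /limE.
split=> [p /Acp cp|]; first by apply/cvg_ex; exists (A p).
by exists (opnorm A) => p /limE ->; exact: opnorm_le.
Qed.

Lemma fourier_rep_cvg A c p : fourier_rep e W A c -> lspan e p ->
  (fun N => free_poly W c N p) @ \oo --> A p.
Proof. by move=> [[cc _] AE] ep; rewrite AE//; exact: cc. Qed.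

Lemma lspan_basis al : lspan e (e al).
Proof. by exists [:: al], (fun=> 1); rewrite big_seq1 scale1r. Qed.

Lemma lspanZ a al : lspan e (a *: e al).
Proof. by exists [:: al], (fun=> a); rewrite big_seq1. Qed.

Lemma fourier_rep_basis_cvg A c al : fourier_rep e W A c ->
  (fun N => free_poly W c N (e al)) @ \oo --> A (e al).
Proof. by move=> Ac; apply: fourier_rep_cvg Ac (lspan_basis al). Qed.

(** Polynomials in [W] commute with [B i], and so do their limits on the span. Conversely, an [A] in
    the commutant is determined by its value at [e [::]], since the [B i] lead from there to every
    basis vector, up to nonzero factors. *)
Lemma FinftyP A : Finfty e W A <-> forall i, A * B i = B i * A.
Proof.
split=> [[c Ac] i|AB].
  apply: bop_eq => al; rewrite !mul_bopE.
  have c1 : (fun N => free_poly W c N (B i (e al))) @ \oo --> A (B i (e al)).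
    by apply: fourier_rep_cvg Ac _; rewrite B_shift; exact: lspanZ.
  apply: (cvg_seq_unique c1).
  have := @cvg_bop _ _ (B i) _ _ (@fourier_rep_basis_cvg A c al Ac).
  apply: cvg_seq_ext => N; rewrite -!mul_bopE comm_free_poly// => j.
  exact: shifts_commute.
(* The coefficients forced by [opword_shift0]: the polynomials applied to [e [::]] become the
   projections of [A (e [::])]. *)
pose c al := inner (A (e [::])) (e al) / (bmu mu al)%:C.
exists c; apply: fourier_repI; elim/last_ind => [|al i IH].
  apply: cvg_seq_ext (@on_proj_cvg _ _ _ _ e_onb (A (e [::]))) => N.
  rewrite free_polyE /on_proj; apply: eq_bigr => al _.
  by rewrite opword_shift0 scalerA /c divfK.
(* Letters are appended on the right because [e (rcons al i)] is a multiple of [B i (e al)], and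
   both [A] and the polynomials commute with [B i]. *)
have r0 : (bmu mu (rcons al i) / bmu mu al)%:C != 0 :> R[i].
  by rewrite gt_eqF// ltcR divr_gt0.
have -> : e (rcons al i) =
    ((bmu mu (rcons al i) / bmu mu al)%:C)^-1 *: B i (e al).
  by rewrite B_shift scalerA mulVf// scale1r.
rewrite bopZ -mul_bopE AB mul_bopE.
have := cvg_seqZ (a := ((bmu mu (rcons al i) / bmu mu al)%:C)^-1)
  (@cvg_bop _ _ (B i) _ _ IH).
apply: cvg_seq_ext => N; rewrite bopZ -!mul_bopE comm_free_poly// => j.
exact: shifts_commute.
Qed.

End Commutant.

Lemma Finfty_subalgebra : unital_subalgebra (Finfty e W).
Proof.
have [B /FinftyP BP] := right_shifts_exist.
split=> [|a A C /BP AB /BP CB|A C /BP AB /BP CB]; apply/BP => i.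
- by rewrite mul1r mulr1.
- apply: bopP => x; rewrite -[LHS]/(a *: (A * B i) x + (C * B i) x) AB CB.
  by rewrite -[RHS]/(B i (a *: A x + C x)) bopD bopZ.
- by rewrite -mulrA CB mulrA AB mulrA.
Qed.

Lemma Finfty_free_poly c m : Finfty e W (free_poly W c m).
Proof.
have [B B_shift] := right_shifts_exist; apply/(FinftyP B_shift) => i.
by apply: comm_free_poly => j; exact: shifts_commute.
Qed.

Lemma Finfty_inverse A C : Finfty e W A -> A * C = 1 -> C * A = 1 ->
  Finfty e W C.
Proof.
have [B /FinftyP BP] := right_shifts_exist.
move=> /BP AB AC CA; apply/BP => i.
by rewrite -[B i in LHS]mulr1 -AC !mulrA -(mulrA C) -AB mulrA CA mul1r.
Qed.

(** The coefficients are thus determined by [A]. At [e [::]], polynomials with [N >= size al] differ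
    only in other basis vectors, so the inner product with [e al] is eventually constant. *)
Lemma fourier_coef A c al : fourier_rep e W A c ->
  inner (A (e [::])) (e al) = c al * (bmu mu al)%:C.
Proof.
move=> Ac; have := @cvg_innerl _ _ _ _ (e al) (@fourier_rep_basis_cvg A c [::] Ac).
move=> c1; apply/esym/(@cvg_seq_unique _ R[i]^o _ _ _ _ c1).
apply: (@cvg_eventually_cst _ R[i]^o _ _ (size al)) => N alN.
rewrite free_polyE.
under eq_bigr do rewrite opword_shift0 scalerA.
by rewrite (inner_on_sum e_on _ _ (wlist_uniq N)) mem_wlist alN.
Qed.

(** If [A] has coefficients [c], then [G] maps [fejer N (A (e [::]))] to [cesaro T c N]; norm
    convergence in [F] is transferred in this way. *)
Definition fejer N (f : F) : F :=
  \sum_(al <- wlist N) ((1 - (size al)%:R / N.+1%:R) * inner f (e al)) *: e al.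

(** The multipliers lie in [0, 1], so the means are contractions and convergence on the span is
    enough. *)
Lemma fejer_cvg f : fejer ^~ f @ \oo --> f.
Proof.
have fejer_lin N : linear (fejer N).
  move=> a g h; rewrite /fejer scaler_sumr -big_split /=.
  apply: eq_bigr => al _; rewrite innerDl innerZl scalerA -scalerDl.
  by congr (_ *: _); ring.
have fejer_le N g : rnorm (fejer N g) <= rnorm g.
  rewrite -(@ler_pXn2r _ 2)// ?nnegrE ?rnorm_ge0//.
  rewrite (rnorm_on_sum e_on _ (wlist_uniq N)).
  apply: le_trans (bessel e_on g (wlist_uniq N)).
  rewrite big_seq [leRHS]big_seq ler_sum// => al; rewrite mem_wlist => alN.
  rewrite cabsM exprMn ler_piMl ?sqr_ge0// expr_le1 ?cabs_ge0//.
  have -> : 1 - (size al)%:R / N.+1%:R = (1 - (size al)%:R / N.+1%:R)%:C :> R[i].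
    by rewrite rmorphB rmorph1 fmorph_div /= !rmorph_nat.
  have q0 : 0 <= (size al)%:R / N.+1%:R :> R by rewrite divr_ge0.
  have q1 : (size al)%:R / N.+1%:R <= 1 :> R.
    by rewrite ler_pdivrMr// mul1r ler_nat ltnW.
  by rewrite cabs_real ger0_norm ?subr_ge0 ?gerBl.
have fejer_basis al : fejer ^~ (e al) @ \oo --> e al.
  apply/cvg_seq_rnormP => d d0.
  (* The second bound makes the error [|al| / (N + 1)] at [e al] smaller than [d]; the first puts
     [al] into [wlist N]. *)
  exists (maxn (size al) (Num.truncn ((size al)%:R / d))) => N.
  rewrite geq_max => /andP[alN dN].
  have -> : fejer N (e al) = (1 - (size al)%:R / N.+1%:R) *: e al.
    rewrite /fejer (bigD1_seq al) ?mem_wlist ?wlist_uniq//= e_on eqxx mulr1.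
    rewrite big1 ?addr0// => be neq.
    by rewrite e_on eq_sym (negPf neq) mulr0 scale0r.
  rewrite -{1}[e al]scale1r -scalerBl subKr rnormZ.
  have -> : (size al)%:R / N.+1%:R = ((size al)%:R / N.+1%:R)%:C :> R[i].
    by rewrite fmorph_div /= !rmorph_nat.
  rewrite (rnorm_on e_on) mulr1 cabs_real ger0_norm ?divr_ge0//.
  rewrite ltr_pdivrMr// mulrC -ltr_pdivrMr//; apply: lt_le_trans (truncnS_gt _) _.
  by rewrite ler_nat.
apply/cvg_seq_rnormP => d d0.
have d3 : 0 < d / 3 by rewrite divr_gt0.
have [_ [[s [c ->]]]] := dense_rnorm f e_onb.2 d3; set p := \sum_(_ <- _) _ => fp.
have : fejer ^~ p @ \oo --> p.
  have := cvg_seq_sum (r := s) (fun al =>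
    cvg_seqZ (a := c al) (@fejer_basis al)).
  apply: cvg_seq_ext => N; rewrite (linear_fun_sum (fejer_lin N)).
  by apply: eq_bigr => al _; rewrite (linear_funZ (fejer_lin N)).
move=> /cvg_seq_rnormP /(_ _ d3)[N hN]; exists N => k /hN pk.
have := rnormB_triangle p f (fejer k f).
have := rnormB_triangle (fejer k p) p (fejer k f).
have := fejer_le k (p - f); rewrite (linear_funB (fejer_lin k)) (rnormB_sym p f).
lra.
Qed.

End Shifts.

(** * The functional calculus *)

Section NormalFunctionals.
Context {R : realType} {H : hilbertType R}.

Lemma sqsummable_tail (x : nat -> H) (d : R) : sqsummable x -> 0 < d ->
  exists N, forall j m, (N <= j)%N -> (j <= m)%N ->
    \sum_(j <= k < m) rnorm (x k) ^+ 2 < d.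
Proof.
move=> /cvg_ex[L /cvg_seq_rnormP xL] d0.
have [N hN] := xL (d / 2) (divr_gt0 d0 (ltr0Sn _ _)).
exists N => j m Nj jm.
have := hN _ Nj; have := hN _ (leq_trans Nj jm).
set u := series _; rewrite rnormB_sym => um uj.
have : rnorm (u m - u j) < d by have := rnormB_triangle L (u m) (u j); lra.
rewrite /u sub_series_geq//.
under eq_bigr do rewrite rnormE -rmorphXn.
rewrite -rmorph_sum -[rnorm _]/(cabs _) cabs_real ger0_norm//.
by apply: sumr_ge0 => k _; exact: sqr_ge0.
Qed.

(** Two such sequences turn a normal functional into a vector functional [inner (A u) v]. *)
Definition single_seq (v : H) (k : nat) : H := if k == 0%N then v else 0.

Lemma single_sqsummable v : sqsummable (single_seq v).
Proof.
apply/cvg_ex; exists (`|v| ^+ 2 : R[i]^o).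
apply: (@cvg_eventually_cst _ R[i]^o _ _ 1) => N N1.
rewrite /series /= big_ltn// big1_seq ?addr0// => k.
rewrite mem_index_iota /single_seq => /andP[_ /andP[/lt0n_neq0/negPf-> _]].
by rewrite normr0 expr0n.
Qed.

Definition single_sqseq v : sqseq H :=
  exist _ (single_seq v) (@single_sqsummable v).

Lemma normal_functional_single u v (A : bop H) :
  normal_functional (single_sqseq u, single_sqseq v) A = inner (A u) v.
Proof.
apply: (cvg_lim (@norm_hausdorff _ R[i]^o)).
apply: (@cvg_eventually_cst _ R[i]^o _ _ 1) => N N1.
rewrite /series /= big_ltn// big1_seq ?addr0// => k.
rewrite mem_index_iota /single_seq => /andP[_ /andP[/lt0n_neq0/negPf-> _]].
by rewrite bop0 -(scale0r (0 : H)) innerZl mul0r.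
Qed.

(* Each [f |-> <G f x_k, y_k>] is represented by a vector [z_k], and the [z_k]
   are summable by the Cauchy-Schwarz inequality. *)
Lemma normal_functional_pullback {F : hilbertType R} (G : F -> bop H) (C : R)
    (p : sqseq H * sqseq H) : 0 <= C ->
  (forall h, linear (fun f => G f h)) ->
  (forall f h, rnorm (G f h) <= C * rnorm h * rnorm f) ->
  exists z, forall f, normal_functional p (G f) = inner f z.
Proof.
case: p => -[x sx] [y sy] C0 G_lin G_le.
have G_bd k f : cabs (inner (G f (x k)) (y k)) <=
    C * rnorm (x k) * rnorm (y k) * rnorm f.
  rewrite (le_trans (cauchy_schwarz _ _))// (mulrAC _ (rnorm (y k))).
  by rewrite ler_wpM2r ?rnorm_ge0.
have /choice[z zE] : forall k, exists z : F,
    forall f, inner (G f (x k)) (y k) = inner f z.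
  move=> k; apply: (@riesz _ _ (fun f => inner (G f (x k)) (y k)) _ _ (G_bd k)).
  by move=> a f g; rewrite G_lin innerDl innerZl.
(* By [2 a b <= a^2 + b^2], the product of norms is replaced by squares, whose tails are small. *)
have z_le k : rnorm (z k) <= C / 2 * (rnorm (x k) ^+ 2 + rnorm (y k) ^+ 2).
  apply: (@le_trans _ _ (C * (rnorm (x k) * rnorm (y k)))); last first.
    rewrite mulrAC -mulrA ler_wpM2l// ler_pdivlMr//.
    have := sqr_ge0 (rnorm (x k) - rnorm (y k)); nra.
  have [z0|z0] := eqVneq (rnorm (z k)) 0; first by rewrite z0 !mulr_ge0 ?rnorm_ge0.
  have z0' : 0 < rnorm (z k) by rewrite lt_neqAle eq_sym z0 rnorm_ge0.
  rewrite -(ler_pM2r z0') -expr2 rnorm_sqr -zE (le_trans (cRe_le_cabs _))//.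
  by rewrite mulrA G_bd.
have [w zw] : exists w : F, series z @ \oo --> w.
  apply: cauchy_rnorm_cvg => d d0.
  have C1 : 0 < C + 1 by rewrite ltr_wpDl.
  have [Nx hx] := sqsummable_tail sx (divr_gt0 d0 C1).
  have [Ny hy] := sqsummable_tail sy (divr_gt0 d0 C1).
  exists (maxn Nx Ny).
  suff hjm j m : (maxn Nx Ny <= j)%N -> (j <= m)%N ->
      rnorm (series z m - series z j) < d.
    move=> j k Nj Nk; have [jk|/ltnW kj] := leqP j k; last exact: hjm.
    by rewrite rnormB_sym hjm.
  rewrite geq_max => /andP[Nxj Nyj] jm; rewrite sub_series_geq//.
  apply: le_lt_trans (rnorm_sum _ _ _) _.
  apply: (@le_lt_trans _ _
    (\sum_(j <= k < m) C / 2 * (rnorm (x k) ^+ 2 + rnorm (y k) ^+ 2))).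
    by apply: ler_sum => k _; exact: z_le.
  rewrite -mulr_sumr big_split /=.
  have := hx _ _ Nxj jm; have := hy _ _ Nyj jm.
  have : 0 <= \sum_(j <= k < m) rnorm (x k) ^+ 2.
    by apply: sumr_ge0 => k _; exact: sqr_ge0.
  have : 0 <= \sum_(j <= k < m) rnorm (y k) ^+ 2.
    by apply: sumr_ge0 => k _; exact: sqr_ge0.
  rewrite !ltr_pdivlMr//; nra.
exists w => f; apply: (cvg_lim (@norm_hausdorff _ R[i]^o)).
apply: cvg_seq_ext (@cvg_innerr _ _ _ _ f zw) => N /=.
by rewrite /series /= inner_sumr; apply: eq_bigr => k _; rewrite zE.
Qed.

End NormalFunctionals.

(** * Properties of the map [A |-> G (A e_0)] *)

Section FunctionalCalculus.
Context {R : realType} {n : nat} {mu : word n -> R}.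
Context {F : hilbertType R} {e : word n -> F} {W : 'I_n -> bop F}.
Context {H : hilbertType R} {T : 'I_n -> bop H} {S : bop H} {G : F -> bop H}.
Hypothesis mu_adm : admissible_weights mu.
Hypothesis e_onb : orthonormal_basis e.
Hypothesis W_shift : weighted_left_shift e W mu.
Hypothesis G_synth : is_synthesis (mu := mu) (e := e) (T := T) (S := S) G.
Implicit Types (A : bop F) (c : word n -> R[i]) (f : F) (h : H).

Let mu_gt0 al : 0 < mu al. Proof. by have [_ + _ _] := mu_adm. Qed.
Let bmu_gt0 al : 0 < bmu mu al. Proof. exact: bmu_gt0. Qed.

Definition calculus (A : bop F) : bop H := G (A (e [::])).

Lemma synthesis_basis al : G (e al) = ((bmu mu al)^-1)%:C *: opword T al.
Proof. by have [_ _ _] := G_synth. Qed.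

Lemma synthesis_vacuum : G (e [::]) = 1.
Proof. by rewrite synthesis_basis /= invr1 scale1r /opword big_nil. Qed.

(** The intertwining relation at a basis vector: applying the shift of a word [be] replaces the
    weight of [be ++ al] by that of [al], which is the one in [G (e al)]. *)
Lemma synthesis_free_poly c N al :
  G (free_poly W c N (e al)) = free_poly T c N * G (e al).
Proof.
rewrite free_polyE (synthesis_sum G_synth); apply: bopP => h.
rewrite mul_bopE free_polyE sum_bopE; apply: eq_bigr => be _.
rewrite (opword_shift mu_adm W_shift) (synthesisZ G_synth) !synthesis_basis.
rewrite -[LHS]/(c be *: (_ *: (_ *: opword T (be ++ al) h))) opword_cat.
rewrite -[X in _ = _ *: opword T be X]/(_ *: opword T al h) bopZ.
congr (_ *: _); rewrite scalerA -rmorphM /=; congr (_%:C *: _).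
by field; rewrite !gt_eqF.
Qed.

Lemma calculus_free_poly c N : calculus (free_poly W c N) = free_poly T c N.
Proof. by rewrite /calculus synthesis_free_poly synthesis_vacuum mulr1. Qed.

Lemma calculus_cesaro A c : fourier_rep e W A c ->
  Defs.cesaro T c @ \oo --> (calculus A : sot H).
Proof.
move=> Ac; apply/sot_cvgP => h.
have := @synthesis_cvg _ _ _ _ _ _ _ _ _ G_synth _ _ h
  (@fejer_cvg _ _ _ _ e_onb (A (e [::]))).
apply: cvg_seq_ext => N; rewrite /fejer (synthesis_sum G_synth) /Defs.cesaro free_sumE.
congr (bop_fun _ h); apply: eq_bigr => al _.
rewrite (fourier_coef mu_adm e_onb W_shift al Ac) synthesis_basis scalerA.
congr (_ *: _); rewrite -!mulrA -rmorphM /= mulfV ?rmorph1 ?mulr1//.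
by rewrite gt_eqF.
Qed.

(** Both sides are bounded and linear in [f], so [f = e al] is enough. There both are limits of
    [free_poly T c N (G (e al) h)]: the left one through [A (e al)], the right one through [A (e
    [::])], with [G] evaluated at the vector [G (e al) h]. *)
Lemma synthesis_Finfty A f : Finfty e W A -> G (A f) = calculus A * G f.
Proof.
move=> [c Ac]; apply: bopP => h; rewrite mul_bopE; move: f.
pose C := Num.sqrt (opnorm S).
have C0 : 0 <= C := sqrtr_ge0 _.
have AGl : linear (fun f => G (A f) h).
  by move=> a f g; rewrite bopD bopZ (synthesis_linear G_synth h).
have GGl : linear (fun f => calculus A (G f h)).
  by move=> a f g; rewrite (synthesis_linear G_synth h) bopD bopZ.
have AGle f : rnorm (G (A f) h) <= C * rnorm h * opnorm A * rnorm f.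
  apply: le_trans (synthesis_le G_synth _ _) _.
  by rewrite -[leRHS]mulrA ler_wpM2l ?opnorm_le// mulr_ge0 ?rnorm_ge0.
have GGle f : rnorm (calculus A (G f h)) <=
    opnorm (calculus A) * (C * rnorm h) * rnorm f.
  apply: le_trans (opnorm_le _ _) _.
  by rewrite -mulrA ler_wpM2l ?opnorm_ge0// (synthesis_le G_synth).
apply: (bop_eq_basis e_onb AGl GGl AGle GGle) => al.
have cvgA be k := @synthesis_cvg _ _ _ _ _ _ _ _ _ G_synth _ _ k
  (@fourier_rep_basis_cvg _ _ _ _ _ A c be Ac).
apply: (cvg_seq_unique (@cvgA al h)).
apply: cvg_seq_ext (@cvgA [::] (G (e al) h)) => N.
by rewrite !synthesis_free_poly synthesis_vacuum mulr1.
Qed.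

Lemma calculus_hom : unital_algebra_hom (Finfty e W) calculus.
Proof.
split=> [|a A B _ _|A B FA FB].
- exact: synthesis_vacuum.
- by have [l _ _ _] := G_synth; exact: l.
- exact: (@synthesis_Finfty A (B (e [::])) FA).
Qed.

Lemma calculus_wot (A : nat -> bop F) L : A @ \oo --> (L : wot F) ->
  (fun k => calculus (A k)) @ \oo --> (calculus L : wot H).
Proof.
move=> /wot_cvgP AL; apply/wot_cvgP => x y.
have [z zE] : exists z, forall f, inner (G f x) y = inner f z.
  pose M := Num.sqrt (opnorm S) * rnorm x * rnorm y.
  apply: (@riesz _ _ (fun f => inner (G f x) y) M) => [a f g|f].
    by rewrite (synthesis_linear G_synth x) innerDl innerZl.
  rewrite (le_trans (cauchy_schwarz _ _))// /M (mulrAC _ (rnorm y)).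
  by rewrite ler_wpM2r ?rnorm_ge0// (synthesis_le G_synth).
rewrite /calculus zE; apply: cvg_seq_ext (AL (e [::]) z) => k.
by rewrite zE.
Qed.

Lemma calculus_sot (A : nat -> bop F) L : A @ \oo --> (L : sot F) ->
  (fun k => calculus (A k)) @ \oo --> (calculus L : sot H).
Proof.
move=> /sot_cvgP AL; apply/sot_cvgP => x.
exact: (@synthesis_cvg _ _ _ _ _ _ _ _ _ G_synth _ _ x (AL (e [::]))).
Qed.

Lemma calculus_wstar : continuous (calculus : wstar F -> wstar H).
Proof.
move=> A.
have FA : Filter (nbhs (A : wstar F)) by exact: nbhs_filter.
apply/wstar_cvgP => p.
have [z zE] := normal_functional_pullback p (sqrtr_ge0 _)
  (synthesis_linear G_synth) (synthesis_le G_synth).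
(* This pair makes [<B e_0, z>] one of the functionals that define the w*-topology of B(F). *)
pose q := (single_sqseq (e [::]), single_sqseq z).
have qE B : normal_functional p (calculus B) = normal_functional q B.
  by rewrite normal_functional_single zE.
have : normal_functional q B @[B --> (A : wstar F)] --> normal_functional q A.
  by have /wstar_cvgP := @cvg_id _ (nbhs (A : wstar F)).
rewrite -qE; under [X in X @ _ --> _]funext do rewrite -qE.
exact.
Qed.

Lemma calculus_cb_norm : dmu_sum mu T S ->
  (cb_norm (Finfty e W) calculus <= (Num.sqrt (opnorm S))%:E)%E.
Proof.
move=> TS; apply: ge_ereal_sup => _ [k [M [_ M1 ->]]]; rewrite lee_fin.
apply: (synthesis_mxop_norm mu_gt0 e_onb G_synth TS) M1.
exact: rnorm_on e_onb.1 _.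
Qed.

Lemma calculus_spectrum A : Finfty e W A ->
  spectrum (calculus A) `<=` spectrum A.
Proof.
move=> FA z zA [B [BA AB]]; apply: zA.
have [F1 FD _] := Finfty_subalgebra mu_adm e_onb W_shift.
have [C1 CD CM] := calculus_hom.
have AzE : A - z *: (1 : bop F) = (- z) *: (1 : bop F) + A.
  by rewrite addrC scaleNr.
have FAz : Finfty e W (A - z *: (1 : bop F)) by rewrite AzE; exact: FD.
(* Multiplicativity holds on F^infty, so the inverse has to lie there too. *)
have FB := Finfty_inverse mu_adm e_onb W_shift FAz AB BA.
have CAz : calculus (A - z *: (1 : bop F)) = calculus A - z *: (1 : bop H).
  by rewrite AzE CD// C1 scaleNr addrC.
by exists (calculus B); rewrite -CAz -!CM// BA AB C1.
Qed.

End FunctionalCalculus.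

Theorem theorem5p1 (R : realType) (n : nat) (mu : seq 'I_n -> R)
    (mu_adm : admissible_weights mu)
    (F : hilbertType R) (e : seq 'I_n -> F) (e_onb : orthonormal_basis e)
    (W : 'I_n -> bop F) (W_shift : weighted_left_shift e W mu)
    (H : hilbertType R) (H_sep : separable_space H)
    (T : 'I_n -> bop H) (T_dmu : dmu mu T) :
  exists Psi : bop F -> bop H,
    functional_calculus e W T Psi /\
    (forall (m : nat) (c : seq 'I_n -> R[i]),
        Finfty e W (free_poly W c m) /\
        Psi (free_poly W c m) = free_poly T c m) /\
    (forall (A : nat -> bop F) (L : bop F),
        (forall k, Finfty e W (A k)) -> Finfty e W L ->
        (A @ \oo --> (L : wot F) ->
           (fun k => Psi (A k)) @ \oo --> (Psi L : wot H)) /\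
        (A @ \oo --> (L : sot F) ->
           (fun k => Psi (A k)) @ \oo --> (Psi L : sot H))) /\
    (unital_subalgebra (Finfty e W) /\
     unital_algebra_hom (Finfty e W) Psi /\
     completely_bounded (Finfty e W) Psi /\
     (forall S : bop H, dmu_sum mu T S ->
        (cb_norm (Finfty e W) Psi <= (Num.sqrt (opnorm S))%:E)%E)) /\
    {within (Finfty e W : set (wstar F)),
        continuous (Psi : wstar F -> wstar H)} /\
    (forall A : bop F, Finfty e W A ->
        (spectral_radius (Psi A) <= spectral_radius A)%E).
Proof.
have [_ mu_gt0 _ _] := mu_adm; have [S TS] := T_dmu.
have [G G_synth] := synthesis_exists mu_gt0 e_onb TS.
have cb_le (S' : bop H) : dmu_sum mu T S' ->
    (cb_norm (Finfty e W) (calculus (e := e) (G := G)) <=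
      (Num.sqrt (opnorm S'))%:E)%E.
  move=> TS'; suff <- : S = S' by exact: calculus_cb_norm mu_adm e_onb G_synth TS.
  exact (@dmu_sum_unique _ _ _ _ _ _ TS _ TS').
exists (calculus (e := e) (G := G)); split; [|split; [|split; [|split; [|split]]]].
- by move=> A c Ac; exact: (calculus_cesaro mu_adm e_onb W_shift G_synth Ac).
- move=> m c; split; first exact: (Finfty_free_poly mu_adm e_onb W_shift).
  exact: (calculus_free_poly mu_adm W_shift G_synth).
- move=> A L _ _; split => [AL|AL].
    exact: (calculus_wot G_synth AL).
  exact: (calculus_sot G_synth AL).
- split; first exact: (Finfty_subalgebra mu_adm e_onb W_shift).
  split; first exact: (calculus_hom mu_adm e_onb W_shift G_synth).
  split; last exact: cb_le.
  exact: le_lt_trans (cb_le S TS) (ltry _).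
- by apply: continuous_subspaceT; exact: (calculus_wstar G_synth).
- move=> A FA; apply: ereal_sup_le => _ [z zA <-].
  by exists z => //; exact: (calculus_spectrum mu_adm e_onb W_shift G_synth FA).
Qed.
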